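(* Let $K\ge 1$ and $d\ge 1$ be integers, let $\nu>2$, let $U_k\subset\mathbb{R}^d$ for $k=1,\ldots,K$, and let $\phi=(\phi_1,\phi_2,\ldots)$ be a feature mapping from $\mathbb{R}^d$ into a countably infinite-dimensional feature space with the $\ell_2$ inner product. For $r\in\mathbb{N}$ let $\phi^{(r)}(\mathbf{u})=[\phi_1(\mathbf{u}),\ldots,\phi_r(\mathbf{u})]$ denote the first $r$ coordinates of $\phi(\mathbf{u})$, and define covariance functions on $U_k\times U_k$ by $$\Sigma^{(k)}_r(\mathbf{u},\mathbf{v})=\langle\phi^{(r)}(\mathbf{u}),\phi^{(r)}(\mathbf{v})\rangle,\qquad \Sigma^{(k)}(\mathbf{u},\mathbf{v})=\langle\phi(\mathbf{u}),\phi(\mathbf{v})\rangle.$$ Let $\mathcal{W}^{(r)}\in\mathbb{R}^{r\times\cdots\times r}$ ($K$ modes) be a random tensor and define the multilinear function $$g^{(r)}(\mathbf{u}^{(1)},\ldots,\mathbf{u}^{(K)})=\mathcal{W}^{(r)}\times_1\phi^{(r)}(\mathbf{u}^{(1)})\times_2\cdots\times_K\phi^{(r)}(\mathbf{u}^{(K)}),\qquad \mathbf{u}^{(k)}\in U_k.$$ If $\mathcal{W}^{(r)}\sim\mathcal{TT}(\nu,0,\{\mathbf{I}_r\}_{k=1}^K)$, then $g^{(r)}(\mathbf{u}^{(1)},\ldots,\mathbf{u}^{(K)})$ follows a tensor-variate $t$ distribution $\mathcal{TT}(\nu,0,\{\Sigma^{(k)}_r\}_{k=1}^K)$, and it converges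 to the tensor-variate $t$ process $\mathcal{TTP}(\nu,0,\{\Sigma^{(k)}\}_{k=1}^K)$ in distribution as $r\to\infty$.
   Context: Mode products: for $\mathcal{W}\in\mathbb{R}^{r_1\times\cdots\times r_K}$ and $\mathbf{U}\in\mathbb{R}^{n\times r_k}$, the mode-$k$ product $\mathcal{W}\times_k\mathbf{U}\in\mathbb{R}^{r_1\times\cdots\times r_{k-1}\times n\times r_{k+1}\times\cdots\times r_K}$ has entries $(\mathcal{W}\times_k\mathbf{U})_{i_1\ldots i_{k-1}\,j\,i_{k+1}\ldots i_K}=\sum_{i_k=1}^{r_k}w_{i_1\ldots i_K}u_{j i_k}$. A vector $\phi^{(r)}(\mathbf{u})$ is treated as a $1\times r$ matrix, so $g^{(r)}(\mathbf{u}^{(1)},\ldots,\mathbf{u}^{(K)})$ is a scalar. $\mathbf{I}_r$ is the $r\times r$ identity matrix. Tensor-variate $t$ distribution: for $\nu>2$, a mean tensor $\mathcal{B}\in\mathbb{R}^{n_1\times\cdots\times n_K}$, $n=\prod_{k=1}^K n_k$, and $n_k\times n_k$ covariance matrices $\boldsymbol{\Sigma}^{(k)}$, $\mathcal{TT}(\nu,\mathcal{B},\{\boldsymbol{\Sigma}^{(k)}\}_{k=1}^K)$ is the law on $\mathbb{R}^{n_1\times\cdots\times n_K}$ with density $$\frac{\Gamma(\frac{n+\nu}{2})\prod_{k=1}^K|\boldsymbol{\Sigma}^{(k)}|^{-\frac{n}{2n_k}}}{\Gamma(\frac{\nu}{2})(\nu\pi)^{\frac n2}}\left(1+\frac1\nu\left\|(\mathcal{M}-\mathcal{B})\times_1(\boldsymbol{\Sigma}^{(1)})^{-1/2}\times_2\cdots\times_K(\boldsymbol{\Sigma}^{(K)})^{-1/2}\right\|^2\right)^{-\frac12(n+\nu)},$$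 where $\Gamma$ is the Gamma function and $\|\mathcal{A}\|^2$ is the sum of squared entries of $\mathcal{A}$. Tensor-variate $t$ process: a random function $f:U_1\times\cdots\times U_K\to\mathbb{R}$ follows $\mathcal{TTP}(\nu,b,\{\Sigma^{(k)}\}_{k=1}^K)$, with degrees of freedom $\nu>2$, mean function $b:U_1\times\cdots\times U_K\to\mathbb{R}$ and covariance functions $\Sigma^{(k)}:U_k\times U_k\to\mathbb{R}$, if for any finite sets $\{\mathbf{u}^{(k)}_1,\ldots,\mathbf{u}^{(k)}_{n_k}\}\subset U_k$, $k=1,\ldots,K$, the random tensor $[f(\mathbf{u}^{(1)}_{j_1},\ldots,\mathbf{u}^{(K)}_{j_K})]_{j_1,\ldots,j_K}\in\mathbb{R}^{n_1\times\cdots\times n_K}$ has law $\mathcal{TT}(\nu,\mathcal{B},\{\boldsymbol{\Sigma}^{(k)}\}_{k=1}^K)$ with $\boldsymbol{\Sigma}^{(k)}_{ij}=\Sigma^{(k)}(\mathbf{u}^{(k)}_i,\mathbf{u}^{(k)}_j)$ and $\mathcal{B}=[b(\mathbf{u}^{(1)}_{j_1},\ldots,\mathbf{u}^{(K)}_{j_K})]_{j_1,\ldots,j_K}$. Here $b=0$. That $g^{(r)}$ follows $\mathcal{TT}(\nu,0,\{\Sigma^{(k)}_r\}_{k=1}^K)$ refers to the random tensors obtained by evaluating $g^{(r)}$ on such finite sets of locations, with covariance matrices $(\boldsymbol{\Sigma}^{(k)}_r)_{ij}=\Sigma^{(k)}_r(\mathbf{u}^{(k)}_i,\mathbf{u}^{(k)}_j)$;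 convergence in distribution to the process likewise refers to these evaluations.
   Formalization: The laws are asserted only at finite sets of distinct locations where the covariance matrices are positive definite (for g^(r) this forces n_k ≤ r), since otherwise the density is undefined; convergence is to the TT law at such sets, and to the process whenever it exists. *)

(* Defs.v *)
From HB Require Import structures.
From mathcomp Require Import all_boot all_order all_algebra.
From mathcomp Require Import all_classical all_reals all_analysis.

Set Implicit Arguments.
Unset Strict Implicit.
Unset Printing Implicit Defensive.

Import Order.TTheory GRing.Theory Num.Theory.
Import numFieldNormedType.Exports.

Local Open Scope classical_set_scope.
Local Open Scope ring_scope.

(* A tensor of shape (n_1, ..., n_K) is the function giving its entries; modes
   and indices are numbered from 0.  The topology is the product topology (the
   usual one of R^(n_1 x ... x n_K)) and the sigma-algebra is the one generated
   by the coordinates. *)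
Definition multi_index (K : nat) (n : 'I_K -> nat) : finType :=
  {dffun forall k : 'I_K, 'I_(n k)}.

Definition tensor (R : realType) (K : nat) (n : 'I_K -> nat) : Type :=
  {ptws multi_index n -> R}.

HB.instance Definition _ (R : realType) (K : nat) (n : 'I_K -> nat) :=
  Topological.on (tensor R n).
HB.instance Definition _ (R : realType) (K : nat) (n : 'I_K -> nat) :=
  Pointed.on (tensor R n).

Section tensor_measurable.
Context (R : realType) (K : nat) (n : 'I_K -> nat).

Definition cylinders : set (set (tensor R n)) :=
  \bigcup_(i in [set: multi_index n])
    preimage_set_system setT (fun M : tensor R n => M i) measurable.

HB.instance Definition _ := @isMeasurable.Build default_measure_display
  (tensor R n) <<s cylinders >> (@sigma_algebra0 _ _ _)
  (@sigma_algebraC _ _) (@sigma_algebra_bigcup _ _ _).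

End tensor_measurable.

(* Lebesgue measure on R^n, as the n-fold product of the one-dimensional
   Lebesgue measure, then transported to tensors along an enumeration of the
   entries; a product of Lebesgue measures does not depend on the enumeration.
   [measurableTypeR R] is the type R with its Borel sigma-algebra. *)
Section lebesgue_tuple.
Context (R : realType).
Local Notation mR := (measurableTypeR R).

Section step.
Context (n : nat) (m : {sigma_finite_measure set (n.-tuple mR) -> \bar R}).

Definition cons_tuple (p : mR * n.-tuple mR) : n.+1.-tuple mR :=
  [tuple of p.1 :: p.2].

Lemma measurable_cons_tuple : measurable_fun setT cons_tuple.
Proof.
by apply: measurable_cons; [exact: measurable_fst|exact: measurable_snd].
Qed.

Definition lebesgue_tuple_step : set (n.+1.-tuple mR) -> \bar R :=
  pushforward (lebesgue_measure \x m)%E cons_tuple.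

HB.instance Definition _ := Measure.copy lebesgue_tuple_step
  (measure_function_pushforward__canonical__measure_function_Measure
    (lebesgue_measure \x m)%E measurable_cons_tuple).

Lemma lebesgue_tuple_step_sigma_finite : sigma_finite setT lebesgue_tuple_step.
Proof.
have /sigma_finiteP[F [TF ndF Foo]] := sigma_finiteT (@lebesgue_measure R).
have /sigma_finiteP[G [TG ndG Goo]] := sigma_finiteT m.
have mbehead := @measurable_behead _ mR n.
have mhead := @measurable_tnth _ mR _ (@ord0 n).
pose hd (t : n.+1.-tuple mR) : mR := tnth t ord0.
pose tl (t : n.+1.-tuple mR) : n.-tuple mR := [tuple of behead t].
pose H (i : nat) : set (n.+1.-tuple mR) :=   hd @^-1` F i `&` tl @^-1` G i.
exists H.
  apply/esym; rewrite -subTset => t _.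
  have [i _ Fi] : (\bigcup_i F i) (hd t) by rewrite -TF.
  have [j _ Gj] : (\bigcup_j G j) (tl t) by rewrite -TG.
  exists (maxn i j) => //; split.
  - by have /subsetPset := ndF _ _ (leq_maxl i j); exact.
  - by have /subsetPset := ndG _ _ (leq_maxr i j); exact.
move=> i; have [mF Fi] := Foo i; have [mG Gi] := Goo i.
split.
  apply: measurableI.
    by rewrite -[X in measurable X]setTI; exact: mhead.
  by rewrite -[X in measurable X]setTI; exact: mbehead.
rewrite /lebesgue_tuple_step /pushforward.
rewrite (_ : _ @^-1` _ = F i `*` G i).
  by rewrite product_measure1E// lte_mul_pinfty// ge0_fin_numE.
have tlE x y : tl (cons_tuple (x, y)) = y by exact: val_inj.
by apply/seteqP; split => -[x y]; rewrite /H/= tlE.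
Qed.

HB.instance Definition _ := Measure_isSigmaFinite.Build _ _ _
  lebesgue_tuple_step lebesgue_tuple_step_sigma_finite.

End step.

Fixpoint lebesgue_tuple (n : nat) :
    {sigma_finite_measure set (n.-tuple mR) -> \bar R} :=
  match n with
  | 0 => \d_([tuple])
  | n.+1 => lebesgue_tuple_step (lebesgue_tuple n)
  end.

Context (K : nat) (n : 'I_K -> nat).

Definition tensor_of_tuple (t : #|multi_index n|.-tuple mR) : tensor R n :=
  fun i => tnth t (enum_rank i).

Lemma measurable_tensor_of_tuple : measurable_fun setT tensor_of_tuple.
Proof.
apply: (@measurability _ _ _ _ _ _ (@cylinders R K n)) => //.
move=> _ [_ [i _ [A mA <-]] <-]; rewrite !setTI.
by rewrite -[X in measurable X]setTI; exact: (@measurable_tnth _ mR).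
Qed.

Definition tensor_lebesgue : set (tensor R n) -> \bar R :=
  pushforward (lebesgue_tuple #|multi_index n|) tensor_of_tuple.

HB.instance Definition _ := Measure.copy tensor_lebesgue
  (measure_function_pushforward__canonical__measure_function_Measure
    (lebesgue_tuple #|multi_index n|) measurable_tensor_of_tuple).

End lebesgue_tuple.

Section mode_products.
Context (R : realType) (K : nat).
Implicit Types (n m : 'I_K -> nat).

(* Mode-k product.  It is meant for shapes n and n' that agree except possibly
   at k; then the sum has exactly one term for each value of the index i_k.
   Comparing the other indices as natural numbers spares a transport between
   the ordinal types 'I_(n l) and 'I_(n' l). *)
Definition mode_prod n n' (k : 'I_K) (W : tensor R n)
    (A : 'M[R]_(n' k, n k)) : tensor R n' := fun j =>
  \sum_(i : multi_index n | [forall l, (l != k) ==> (i l == j l :> nat)])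
     W i * A (j k) (i k).

Definition replace_modes n m (ks : seq 'I_K) : 'I_K -> nat :=
  fun l => if l \in ks then m l else n l.

(* Products over the modes of the duplicate-free list ks, starting from its
   last element.  When k :: ks is duplicate-free, [conform_mx] is the identity
   transport of A k along replace_modes n m (k :: ks) k = m k and
   replace_modes n m ks k = n k; its default value 0 is not used. *)
Fixpoint mode_prods n m (W : tensor R n) (A : forall k, 'M[R]_(m k, n k))
    (ks : seq 'I_K) : tensor R (replace_modes n m ks) :=
  match ks return tensor R (replace_modes n m ks) with
  | [::] => W
  | k :: ks => @mode_prod (replace_modes n m ks) (replace_modes n m (k :: ks)) k
                 (@mode_prods n m W A ks) (conform_mx 0 (A k))
  end.

Lemma replace_all_modes n m l :
  m l = replace_modes n m (rev (enum 'I_K)) l.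
Proof. by rewrite /replace_modes mem_rev mem_enum. Qed.

(* W x_1 A_1 x_2 ... x_K A_K *)
Definition multilinear_prod n m (W : tensor R n)
    (A : forall k, 'M[R]_(m k, n k)) : tensor R m := fun j =>
  @mode_prods n m W A (rev (enum 'I_K))
    [ffun l => cast_ord (replace_all_modes n m l) (j l)].

Definition tensor_sqnorm n (M : tensor R n) : R := \sum_i M i ^+ 2.

End mode_products.

Definition Gamma (R : realType) (a : R) : R :=
  \int[lebesgue_measure]_(x in `]0, +oo[) (x `^ (a - 1) * expR (- x)).

Definition posdefmx (R : realType) (n : nat) (S : 'M[R]_n) : Prop :=
  S^T = S /\ forall x : 'rV[R]_n, x != 0 -> 0 < (x *m S *m x^T) 0 0.

(* S^(-1/2): the unique positive definite square root of the inverse of the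
   positive definite matrix S. *)
Definition invsqrtmx (R : realType) (n : nat) (S : 'M[R]_n) : 'M[R]_n :=
  xget 0 [set Q | posdefmx Q /\ Q *m Q = invmx S].

Section tensor_t.
Context (R : realType) (K : nat).

Definition tensor_t_pdf (n : 'I_K -> nat) (nu : R) (B : tensor R n)
    (S : forall k, 'M[R]_(n k)) (M : tensor R n) : R :=
  let N : R := (\prod_k n k)%N%:R in
  Gamma ((N + nu) / 2) * (\prod_k (\det (S k)) `^ (- (N / (2 * (n k)%:R))))
  / (Gamma (nu / 2) * (nu * pi) `^ (N / 2))
  * (1 + nu^-1 * tensor_sqnorm (multilinear_prod
       (fun i => M i - B i : R) (fun k => invsqrtmx (S k))))
    `^ (- ((N + nu) / 2)).

(* The random tensor X, on the probability space (T, P), has law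
   TT(nu, B, S).  The density involves S_k^(-1/2) and |S_k|^(-n/(2 n_k)), so
   the law exists only for positive definite S_k. *)
Definition has_tensor_t_law d (T : measurableType d) (P : probability T R)
    (n : 'I_K -> nat) (X : T -> tensor R n) (nu : R) (B : tensor R n)
    (S : forall k, 'M[R]_(n k)) : Prop :=
  [/\ measurable_fun setT X,
      forall k, posdefmx (S k) &
      forall A : set (tensor R n), measurable A ->
        P (X @^-1` A) = (\int[@tensor_lebesgue R K n]_(M in A)
                           (tensor_t_pdf nu B S M)%:E)%E].

End tensor_t.

(* The X_r may live on different probability spaces. *)
Definition cvg_in_distribution (R : realType) (E : topologicalType)
    (d : nat -> measure_display) (T : forall r, measurableType (d r))
    (P : forall r, probability (T r) R) (X : forall r, T r -> E)
    d' (T' : measurableType d') (P' : probability T' R) (Y : T' -> E) : Prop :=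
  forall h : E -> R, continuous h -> (exists C : R, forall x, `|h x| <= C) ->
    (fun r => 'E_(P r)[h \o X r]%E) @ \oo --> 'E_P'[h \o Y]%E.

Section processes.
Context (R : realType) (K : nat) (V : Type).

(* Locations (u_1^(k), ..., u_(n_k)^(k)), k = 1, ..., K: an enumeration without
   repetition of a nonempty finite subset of U_k, for each k. *)
Definition locations (U : 'I_K -> set V) (n : 'I_K -> nat)
    (u : forall k, 'I_(n k) -> V) : Prop :=
  forall k, [/\ (0 < n k)%N, injective (u k) & forall i, U k (u k i)].

Definition eval_tensor (n : 'I_K -> nat) (u : forall k, 'I_(n k) -> V)
    (f : ('I_K -> V) -> R) : tensor R n := fun j => f (fun k => u k (j k)).

Definition cov_mx (n : nat) (S : V -> V -> R) (u : 'I_n -> V) : 'M[R]_n :=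
  \matrix_(i, j) S (u i) (u j).

(* f is a tensor-variate t process on U_1 x ... x U_K; its values outside this
   product are irrelevant. *)
Definition tensor_t_process (U : 'I_K -> set V) d (T : measurableType d)
    (P : probability T R) (f : T -> ('I_K -> V) -> R) (nu : R)
    (b : ('I_K -> V) -> R) (S : 'I_K -> V -> V -> R) : Prop :=
  forall (n : 'I_K -> nat) (u : forall k, 'I_(n k) -> V), locations U u ->
    has_tensor_t_law P (fun w => eval_tensor u (f w)) nu (eval_tensor u b)
      (fun k => cov_mx (S k) (u k)).

End processes.

Section features.
Context (R : realType) (V : Type) (phi : V -> nat -> R).

Definition ell2_features : Prop :=
  forall u, cvgn (series (fun i => phi u i ^+ 2)).

Definition trunc_feature (r : nat) (u : V) : 'rV[R]_r := \row_i phi u i.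

Definition trunc_kernel (r : nat) (u v : V) : R :=
  (trunc_feature r u *m (trunc_feature r v)^T) 0 0.

Definition ell2_kernel (u v : V) : R :=
  limn (series (fun i => phi u i * phi v i)).

Definition multilinear_fun (K r : nat) (W : tensor R (fun _ : 'I_K => r))
    (v : 'I_K -> V) : R :=
  @multilinear_prod R K (fun=> r) (fun=> 1%N) W
    (fun k => trunc_feature r (v k)) [ffun=> ord0].

End features.

(* Main.v *)
Require Import Defs.
From HB Require Import structures.
From mathcomp Require Import all_boot all_order all_algebra.
From mathcomp Require Import all_classical all_reals all_analysis.
From mathcomp Require Import measurable_realfun.
From mathcomp Require Import ring lra.
From mathcomp Require complex.

(** A tensor t density is a mixture of centered Gaussian densities:
    c (1 + q / nu)^(-(N + nu)/2) is the integral over s > 0 of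
    s^(nu/2 - 1) e^(-s) / Gamma(nu/2) against the N-dimensional Gaussian density
    with quadratic form (s / nu) q.  By Tonelli it then suffices to find the
    image of the standard Gaussian on r x ... x r tensors under the Kronecker
    product of the feature matrices A_k.  Diagonalizing A_k A_k^T = P_k^T D_k P_k
    factors this map as a coisometry, a diagonal scaling and an orthogonal map,
    so that no general linear change of variables is needed.  For the limit, the
    covariance matrices converge entrywise and are eventually positive definite,
    hence the densities converge pointwise, and Scheffe's lemma applies. *)

Set Implicit Arguments.
Unset Strict Implicit.
Unset Printing Implicit Defensive.

Import Order.TTheory GRing.Theory Num.Theory.
Import numFieldNormedType.Exports.

Local Open Scope classical_set_scope.
Local Open Scope ring_scope.

(** * Lebesgue measure on tuples and tensors *)

(** The feature maps may lower the dimension. Under an isotropic Gaussian the coordinates that a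
    coisometry discards are independent of those it keeps, so they integrate out. The t density does
    not factor in this way, but its mixing law depends on [nu] alone, not on the shape or the
    covariances, and is therefore common to the source and the image. Gaussians are normalized as
    exp(-t |M|^2), with variance 1/(2t); at t = s / nu, the variable 2s is chi-square with nu
    degrees of freedom, whence the Gamma(nu/2) weight for s. Positive definiteness shapes the limit:
    the Gram matrix of n feature vectors truncated at r < n is singular and gives no density, so the
    evaluations have a t law only once the determinants are close to their positive limits. The
    integral identities are stated for nonnegative functions, so that Tonelli applies without
    integrability conditions; a bounded test function is first shifted by its bound. *)

Section affine_line.
Context {R : realType}.
Local Notation mR := (measurableTypeR R).
Local Notation leb := (@lebesgue_measure R).

Lemma measurable_affine (a b : R) :
  measurable_fun [set: mR] (fun x : mR => a * x + b : mR).
Proof. by apply: measurable_funD => //; exact: measurable_funM. Qed.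

(** The right-hand side is a measure in [A], and Lebesgue measure is determined by its values on the
    intervals []c, d]], so only the preimage of such an interval has to be measured. *)
Lemma lebesgue_measure_affine (a b : R) (A : set mR) : 0 < a -> measurable A ->
  leb A = (a%:E * leb ((fun x : mR => (a * x + b)%R : mR) @^-1` A))%E.
Proof.
move=> a0 mA.
pose g : mR -> mR := fun x => (a * x + b : R).
have mg : measurable_fun setT g by exact: measurable_affine.
pose mu := mscale (NngNum (ltW a0))
  (measure_function_pushforward__canonical__measure_function_Measure leb mg).
apply: (@lebesgue_measure_unique R mu) mA => X cX.
change (leb X = a%:E * leb (g @^-1` X))%E.
move: X cX => _ /ocitvP[->|[[c d]/= cd ->]].
  by rewrite preimage_set0 !measure0 mule0.
have -> : g @^-1` `]c, d]%classic = `](c - b) / a, (d - b) / a]%classic.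
  apply/seteqP; split => x; rewrite /g/= !in_itv/= ltr_pdivrMr// ler_pdivlMr//;
    rewrite ltrBlDr lerBrDr (mulrC x); exact.
rewrite !lebesgue_measure_itv/= !lte_fin cd ltr_pM2r ?invr_gt0// ltrD2r cd.
rewrite -!EFinB -EFinM; congr EFin.
by rewrite -mulrBl mulrC mulfVK ?gt_eqF// opprB addrA subrK.
Qed.

Lemma ge0_integral_affine (a b : R) (f : mR -> \bar R) : 0 < a ->
  measurable_fun setT f -> (forall x, 0 <= f x)%E ->
  (\int[leb]_x f x = a%:E * \int[leb]_x f (a * x + b)%R)%E.
Proof.
move=> a0 mf f0.
pose g : mR -> mR := fun x => (a * x + b : R).
have mg : measurable_fun setT g by exact: measurable_affine.
pose pf := measure_function_pushforward__canonical__measure_function_Measure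
  leb mg.
transitivity (\int[mscale (NngNum (ltW a0)) pf]_x f x)%E.
  by apply: eq_measure_integral => A mA _; exact: lebesgue_measure_affine.
by rewrite ge0_integral_mscale// ge0_integral_pushforward// preimage_setT.
Qed.

End affine_line.

Section tuples.
Context {R : realType}.
Local Notation mR := (measurableTypeR R).
Local Notation leb := (@lebesgue_measure R).
Local Open Scope ereal_scope.

Lemma ge0_integral_lebesgue_tupleS n (f : n.+1.-tuple mR -> \bar R) :
  measurable_fun setT f -> (forall x, 0 <= f x) ->
  \int[lebesgue_tuple R n.+1]_t f t =
  \int[leb]_x \int[lebesgue_tuple R n]_t f (Defs.cons_tuple (x, t)).
Proof.
move=> mf f0; rewrite ge0_integral_pushforward//=; last first.
  exact: measurable_cons_tuple.
rewrite preimage_setT fubini_tonelli1//.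
by apply: measurableT_comp => //; exact: measurable_cons_tuple.
Qed.

Lemma measurable_mktuple d (T : measurableType d) n (f : 'I_n -> T -> mR) :
  (forall i, measurable_fun setT (f i)) ->
  measurable_fun setT (fun x => [tuple f i x | i < n] : n.-tuple mR).
Proof.
move=> mf; apply/measurable_fun_tnthP => i.
by rewrite (_ : _ \o _ = f i)//; apply/funext => x; exact: tnth_mktuple.
Qed.

(** Tonelli splits off the head: the induction hypothesis substitutes in the tail at each fixed
    head, then the one-dimensional formula substitutes in the head. *)
Lemma ge0_integral_tuple_affine n (a b : 'I_n -> R)
    (f : n.-tuple mR -> \bar R) :
  (forall i, 0 < a i)%R -> measurable_fun setT f -> (forall x, 0 <= f x) ->
  \int[lebesgue_tuple R n]_t f t = (\prod_i a i)%:E *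
  \int[lebesgue_tuple R n]_t f [tuple (a i * tnth t i + b i)%R | i < n].
Proof.
elim: n a b f => [|n IH] a b f a0 mf f0.
  rewrite big_ord0 mul1e; apply: eq_integral => t _.
  by congr f; apply: eq_from_tnth => -[].
have maff : measurable_fun setT (fun t : n.+1.-tuple mR =>
    [tuple (a i * tnth t i + b i)%R | i < n.+1] : n.+1.-tuple mR).
  apply: (@measurable_mktuple _ _ _
    (fun i (t : n.+1.-tuple mR) => (a i * tnth t i + b i)%R)) => i.
  by apply: measurableT_comp (measurable_affine (a i) (b i)) _; exact: measurable_tnth.
rewrite !ge0_integral_lebesgue_tupleS//; last exact: measurableT_comp.
have mfc : measurable_fun setT (fun p : mR * n.-tuple mR => f (Defs.cons_tuple p)).
  by apply: measurableT_comp => //; exact: measurable_cons_tuple.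
pose a' i := a (lift ord0 i); pose b' i := b (lift ord0 i).
have tE x t : [tuple (a i * tnth (Defs.cons_tuple (x, t)) i + b i)%R | i < n.+1] =
    Defs.cons_tuple ((a ord0 * x + b ord0)%R : mR,
      [tuple (a' i * tnth t i + b' i)%R | i < n] : n.-tuple mR).
  apply: eq_from_tnth => i; rewrite tnth_mktuple.
  case: (unliftP ord0 i) => [j ->|->]; last by rewrite !tnth0.
  by rewrite !tnthS tnth_mktuple.
under [in RHS]eq_integral do under eq_integral do rewrite tE.
pose F (x : mR) := \int[lebesgue_tuple R n]_t f (Defs.cons_tuple (x, t)).
have FE x : F x = (\prod_i a' i)%:E *
    \int[lebesgue_tuple R n]_t f (Defs.cons_tuple (x : mR,
      [tuple (a' i * tnth t i + b' i)%R | i < n] : n.-tuple mR)).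
  apply: (IH a' b' (fun t => f (Defs.cons_tuple (x, t)))) => //.
    by move=> i; exact: a0.
  exact: (measurableT_comp mfc (pair1_measurable x)).
have mF : measurable_fun setT F by exact:
  (@measurable_fun_fubini_tonelli_F _ _ _ _ _ (lebesgue_tuple R n)
    (fun p : mR * n.-tuple mR => f (Defs.cons_tuple p))).
rewrite (@ge0_integral_affine _ (a ord0) (b ord0) F)//; last first.
  by move=> x; exact: integral_ge0.
rewrite big_ord_recl EFinM -muleA; congr *%E.
transitivity (\int[leb]_x ((\prod_i a' i)%:E *
    \int[lebesgue_tuple R n]_t f (Defs.cons_tuple ((a ord0 * x + b ord0)%R : mR,
      [tuple (a' i * tnth t i + b' i)%R | i < n] : n.-tuple mR)))).
  by apply: eq_integral => x _; exact: FE.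
rewrite ge0_integralZl//.
- apply: (@measurable_fun_fubini_tonelli_F _ _ _ _ _ (lebesgue_tuple R n)
   (fun p : mR * n.-tuple mR => f (Defs.cons_tuple ((a ord0 * p.1 + b ord0)%R : mR,
      [tuple (a' i * tnth p.2 i + b' i)%R | i < n] : n.-tuple mR)))) => //=.
  apply: (measurableT_comp mfc); apply: measurable_fun_pair => /=.
    by apply: measurableT_comp (measurable_affine _ _) _; exact: measurable_fst.
  apply: (@measurable_mktuple _ _ _
    (fun i (p : mR * n.-tuple mR) => (a' i * tnth p.2 i + b' i)%R)) => i.
  apply: measurableT_comp (measurable_affine (a' i) (b' i)) _.
  exact: (measurableT_comp (measurable_tnth i) measurable_snd).
- by move=> x _; exact: integral_ge0.
- by rewrite lee_fin; apply: prodr_ge0 => i _; exact/ltW/a0.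
Qed.

Lemma ge0_integral_tuple_prod n (psi : mR -> R) :
  measurable_fun setT psi -> (forall x, 0 <= psi x)%R ->
  \int[leb]_x (psi x)%:E = 1 ->
  \int[lebesgue_tuple R n]_t (\prod_(i < n) psi (tnth t i))%:E = 1.
Proof.
move=> mpsi psi0 psi1; elim: n => [|n IH].
  under eq_integral do rewrite big_ord0.
  by rewrite integral_cst//= diracT mul1e.
have p0 m (t : m.-tuple mR) : (0 <= \prod_(i < m) psi (tnth t i))%R.
  exact: prodr_ge0.
have mp m : measurable_fun setT (fun t : m.-tuple mR =>
    (\prod_(i < m) psi (tnth t i))%:E).
  apply/measurable_EFinP; apply: measurable_prod => i _.
  by apply: measurableT_comp => //; exact: measurable_tnth.
rewrite ge0_integral_lebesgue_tupleS; last 2 first.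
- exact: mp.
- by move=> t; rewrite lee_fin.
rewrite -psi1; apply: eq_integral => x _.
transitivity (\int[lebesgue_tuple R n]_t
    ((psi x)%:E * (\prod_(i < n) psi (tnth t i))%:E)).
  apply: eq_integral => t _; rewrite big_ord_recl tnth0 EFinM; congr (_ * _%:E).
  by apply: eq_bigr => i _; rewrite tnthS.
rewrite ge0_integralZl ?IH ?mule1//; first exact: mp.
  by move=> t _; rewrite lee_fin.
by rewrite lee_fin.
Qed.

End tuples.

Section tensor_measure.
Context {R : realType} {K : nat}.
Local Notation mR := (measurableTypeR R).
Implicit Types n : 'I_K -> nat.

Lemma measurable_coord n (i : multi_index n) :
  measurable_fun setT (fun M : tensor R n => M i).
Proof.
move=> _ Y mY; rewrite setTI; apply: sub_sigma_algebra.
by exists i => //; exists Y => //; rewrite setTI.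
Qed.

Lemma measurable_to_tensor d (T : measurableType d) n (f : T -> tensor R n) :
  (forall i, measurable_fun setT (fun x => f x i)) -> measurable_fun setT f.
Proof.
move=> mf; apply: (@measurability _ _ _ _ _ _ (@cylinders R K n)) => //.
move=> _ [_ [i _ [A mA <-]] <-]; rewrite !setTI.
by rewrite -[X in measurable X]setTI; exact: mf.
Qed.

Definition tuple_of_tensor n (M : tensor R n) : #|multi_index n|.-tuple mR :=
  [tuple M (enum_val i) | i < #|multi_index n|].

Lemma measurable_tuple_of_tensor n :
  measurable_fun setT (@tuple_of_tensor n).
Proof.
apply: (@measurable_mktuple _ _ _ _ (fun i (M : tensor R n) => M (enum_val i))).
by move=> i; exact: measurable_coord.
Qed.

Lemma tensor_of_tupleK n :
  cancel (@tensor_of_tuple R K n) (@tuple_of_tensor n).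
Proof.
move=> t; apply: eq_from_tnth => i.
by rewrite tnth_mktuple /tensor_of_tuple enum_valK.
Qed.

(** The Tonelli theorems need sigma-finiteness. Pulling an exhaustion of the tuples back along
    [tuple_of_tensor] keeps the measures, by [tensor_of_tupleK]. *)
Lemma sigma_finite_tensor_lebesgue n :
  sigma_finite setT (@tensor_lebesgue R K n).
Proof.
have /sigma_finiteP[G [TG ndG Goo]] :=
  sigma_finiteT (lebesgue_tuple R #|multi_index n|).
exists (fun i => @tuple_of_tensor n @^-1` G i).
  apply/esym; rewrite -subTset => M _.
  by have : setT (tuple_of_tensor M) by []; rewrite TG => -[i _ Gi]; exists i.
move=> i; have [mG Gi] := Goo i; split.
  by rewrite -[X in measurable X]setTI; exact: measurable_tuple_of_tensor.
rewrite /tensor_lebesgue /pushforward -comp_preimage.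
by rewrite (_ : _ @^-1` _ = G i)//; apply/seteqP; split => t /=;
  rewrite tensor_of_tupleK.
Qed.

HB.instance Definition _ n := Measure_isSigmaFinite.Build _ _ _
  (@tensor_lebesgue R K n) (@sigma_finite_tensor_lebesgue n).

Local Open Scope ereal_scope.

Lemma ge0_integral_tensor_lebesgue n (f : tensor R n -> \bar R) :
  measurable_fun setT f -> (forall M, 0 <= f M) ->
  \int[@tensor_lebesgue R K n]_M f M =
  \int[lebesgue_tuple R #|multi_index n|]_t f (tensor_of_tuple t).
Proof.
move=> mf f0; rewrite ge0_integral_pushforward//.
exact: measurable_tensor_of_tuple.
Qed.

Lemma measurable_tensor_affine n (a b : multi_index n -> R) :
  measurable_fun setT
    (fun M : tensor R n => (fun i => a i * M i + b i)%R : tensor R n).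
Proof.
apply: measurable_to_tensor => i.
by apply: measurable_funD => //; apply: measurable_funM => //;
  exact: measurable_coord.
Qed.

(** Two cases are used later: [a = 1], translation, for the shears, and [b = 0] for the diagonal
    factor. *)
Lemma ge0_integral_tensor_affine n (a b : multi_index n -> R)
    (f : tensor R n -> \bar R) :
  (forall i, 0 < a i)%R -> measurable_fun setT f -> (forall M, 0 <= f M) ->
  \int[@tensor_lebesgue R K n]_M f M = (\prod_i a i)%:E *
  \int[@tensor_lebesgue R K n]_M f (fun i => a i * M i + b i)%R.
Proof.
move=> a0 mf f0; rewrite !ge0_integral_tensor_lebesgue//; last first.
  exact: (measurableT_comp mf (measurable_tensor_affine a b)).
rewrite (@ge0_integral_tuple_affine _ _ (a \o enum_val) (b \o enum_val))//=.
- congr (_%:E * _).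
    rewrite (reindex (@enum_rank _)) /=; last exact/onW_bij/enum_rank_bij.
    by apply: eq_bigr => i _; rewrite enum_rankK.
  apply: eq_integral => t _; congr f; apply/funext => i.
  by rewrite /tensor_of_tuple tnth_mktuple/= enum_rankK.
- exact: (measurableT_comp mf (@measurable_tensor_of_tuple R K n)).
Qed.

Lemma ge0_integral_tensor_shift n (f : tensor R n -> \bar R) (v : tensor R n) :
  measurable_fun setT f -> (forall M, 0 <= f M) ->
  \int[@tensor_lebesgue R K n]_M f (fun i => M i + v i)%R =
  \int[@tensor_lebesgue R K n]_M f M.
Proof.
move=> mf f0; rewrite (@ge0_integral_tensor_affine n (fun=> 1%R) v f)//.
rewrite big1// mul1e; apply: eq_integral => M _; congr f.
by apply/funext => i; rewrite mul1r.
Qed.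

Lemma ge0_integral_tensor_prod n (psi : R -> R) :
  measurable_fun [set: mR] psi -> (forall x, 0 <= psi x)%R ->
  \int[lebesgue_measure]_x (psi x)%:E = 1 ->
  \int[@tensor_lebesgue R K n]_M (\prod_i psi (M i))%:E = 1.
Proof.
move=> mpsi psi0 psi1; rewrite ge0_integral_tensor_lebesgue; last 2 first.
- apply/measurable_EFinP; apply: measurable_prod => i _.
  exact: (measurableT_comp mpsi (measurable_coord i)).
- by move=> M; rewrite lee_fin; exact: prodr_ge0.
rewrite -(@ge0_integral_tuple_prod _ #|multi_index n| psi)//.
apply: eq_integral => t _; congr EFin.
rewrite [RHS](reindex (@enum_rank _))//=; last exact/onW_bij/enum_rank_bij.
Qed.

End tensor_measure.

(** * Gaussian measures under coisometries *)

Section linear_maps.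
Context {R : realType} {K : nat}.
Implicit Types n m : 'I_K -> nat.

Definition tensor_dot n (M N : tensor R n) : R := \sum_i M i * N i.

Definition tensor_lin n m (a : multi_index m -> multi_index n -> R)
    (M : tensor R n) : tensor R m := fun j => \sum_i M i * a j i.

Lemma measurable_tensor_lin n m (a : multi_index m -> multi_index n -> R) :
  measurable_fun setT (tensor_lin a).
Proof.
apply: measurable_to_tensor => j; apply: measurable_sum => i.
by apply: measurable_funM => //; exact: measurable_coord.
Qed.

Lemma measurable_tensor_sqnorm n : measurable_fun setT (@tensor_sqnorm R K n).
Proof.
apply: measurable_sum => i; apply: measurable_funX; exact: measurable_coord.
Qed.

Lemma tensor_dot_lin n m (a : multi_index m -> multi_index n -> R) M N :
  tensor_dot (tensor_lin a M) N = tensor_dot M (tensor_lin (fun i j => a j i) N).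
Proof.
rewrite /tensor_dot /tensor_lin; under eq_bigr do rewrite mulr_suml.
rewrite exchange_big/=; apply: eq_bigr => i _; rewrite mulr_sumr.
by apply: eq_bigr => j _; rewrite -mulrA (mulrC (N j)).
Qed.

Lemma tensor_lin_comp n m p (a : multi_index m -> multi_index n -> R)
    (b : multi_index p -> multi_index m -> R) M :
  tensor_lin b (tensor_lin a M) =
  tensor_lin (fun l i => \sum_j b l j * a j i) M.
Proof.
apply/funext => l; rewrite /tensor_lin.
under eq_bigr do rewrite mulr_suml.
rewrite exchange_big/=; apply: eq_bigr => i _; rewrite mulr_sumr.
by apply: eq_bigr => j _; rewrite -mulrA (mulrC (a j i)).
Qed.

Lemma tensor_lin1 n (M : tensor R n) : tensor_lin (fun i j => (i == j)%:R) M = M.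
Proof.
apply/funext => i; rewrite /tensor_lin (bigD1 i)//= eqxx mulr1 big1 ?addr0//.
by move=> j ji; rewrite eq_sym (negbTE ji) mulr0.
Qed.

Lemma tensor_sqnormE n (M : tensor R n) : tensor_sqnorm M = tensor_dot M M.
Proof. by apply: eq_bigr => i _; rewrite expr2. Qed.

(** In matrix form, a a^T = 1: the rows are orthonormal, and the source may be larger than the
    target. *)
Definition coisometry n m (a : multi_index m -> multi_index n -> R) :=
  forall j l, \sum_i a j i * a l i = (j == l)%:R.

Lemma coisometryK n m (a : multi_index m -> multi_index n -> R) M :
  coisometry a -> tensor_lin a (tensor_lin (fun i j => a j i) M) = M.
Proof.
move=> ca; rewrite tensor_lin_comp -[RHS]tensor_lin1.
by congr tensor_lin; apply/funext => j; apply/funext => l; rewrite ca.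
Qed.

Lemma sqnorm_tensor_lin_adj n m (a : multi_index m -> multi_index n -> R) N :
  coisometry a ->
  tensor_sqnorm (tensor_lin (fun i j => a j i) N) = tensor_sqnorm N.
Proof.
by move=> ca; rewrite !tensor_sqnormE (tensor_dot_lin (fun i j => a j i)) coisometryK.
Qed.

Definition shear n m (b : multi_index m -> multi_index n -> R)
  (M : tensor R n) (N : tensor R m) : tensor R m :=
  fun j => N j + tensor_lin b M j.

Lemma sqnorm_shear n m (b : multi_index m -> multi_index n -> R) M N :
  tensor_sqnorm (shear b M N) = tensor_sqnorm N + 2 * tensor_dot (tensor_lin b M) N
    + tensor_sqnorm (tensor_lin b M).
Proof.
rewrite /tensor_sqnorm /tensor_dot /shear mulr_sumr -!big_split/=.
by apply: eq_bigr => j _; rewrite sqrrD -mulr_natl (mulrC (N j)).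
Qed.

(* The block matrix [[0, a], [-a^T, 1 - a^T a]] is orthogonal and is the product
   of unitriangular block matrices [[1, a], [0, 1]], [[1, 0], [-a^T, 1]] and
   [[1, a], [0, 1]]: orthogonal invariance thus reduces to Fubini and
   translation invariance. *)
Lemma shear3 n m (a : multi_index m -> multi_index n -> R) M N :
  coisometry a ->
  let N1 := shear a M N in let M1 := shear (fun i j => - a j i) N1 M in
  shear a M1 N1 = tensor_lin a M.
Proof.
move=> ca N1 M1; apply/funext => j; rewrite /shear.
have -> : tensor_lin a M1 j = tensor_lin a M j - N1 j.
  rewrite -[in RHS](coisometryK N1 ca) /tensor_lin -sumrB; apply: eq_bigr => i _.
  rewrite /M1 /shear mulrDl; congr (_ + _); rewrite -mulNr; congr (_ * _).
  by rewrite /tensor_lin -sumrN; apply: eq_bigr => l _; rewrite mulrN.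
by rewrite addrCA subrr addr0.
Qed.

(** This is the orthogonality of the block matrix above. The adjoint of a coisometry preserves
    norms, so |M1|^2 = |N1|^2 - 2 <N1, aM> + |M|^2; with N1 = N + aM the cross terms cancel and
    |N|^2 + |M|^2 - |aM|^2 remains. *)
Lemma sqnorm_shear3 n m (a : multi_index m -> multi_index n -> R) M N :
  coisometry a ->
  let N1 := shear a M N in let M1 := shear (fun i j => - a j i) N1 M in
  tensor_sqnorm (tensor_lin a M) + tensor_sqnorm M1 =
  tensor_sqnorm N + tensor_sqnorm M.
Proof.
move=> ca N1 M1.
have linN : tensor_lin (fun i j => - a j i) N1 =
    fun i => - tensor_lin (fun i j => a j i) N1 i.
  by apply/funext => i; rewrite /tensor_lin -sumrN; apply: eq_bigr => l _; rewrite mulrN.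
rewrite /M1 sqnorm_shear linN.
have -> (X : tensor R n) : tensor_sqnorm (fun i => - X i) = tensor_sqnorm X.
  by apply: eq_bigr => i _; rewrite sqrrN.
rewrite (sqnorm_tensor_lin_adj N1 ca).
have -> (X : tensor R n) : tensor_dot (fun i => - X i) M = - tensor_dot X M.
  by rewrite /tensor_dot -sumrN; apply: eq_bigr => i _; rewrite mulNr.
rewrite tensor_dot_lin /N1 sqnorm_shear.
have -> (X : tensor R m) : tensor_dot (shear a M N) X =
    tensor_dot N X + tensor_dot (tensor_lin a M) X.
  by rewrite /tensor_dot -big_split; apply: eq_bigr => i _; rewrite /shear mulrDl.
rewrite -tensor_sqnormE.
have -> : tensor_dot N (tensor_lin a M) = tensor_dot (tensor_lin a M) N.
  by apply: eq_bigr => i _; rewrite mulrC.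
rewrite /=.
move: (tensor_sqnorm _) (tensor_sqnorm M) (tensor_sqnorm N) (tensor_dot _ _).
by move=> u v w z; rewrite mulrN mulrDr; ring.
Qed.

End linear_maps.

Section gaussian.
Context {R : realType} {K : nat}.
Local Notation mR := (measurableTypeR R).
Implicit Types (n m : 'I_K -> nat) (t : R).

(** The centered Gaussian density of variance 1/(2t); with this parameter the mixing variable enters
    the exponent linearly. *)
Definition gauss1 t (x : R) : R := Num.sqrt (t / pi) * expR (- (t * x ^+ 2)).

Lemma gauss1_ge0 t x : 0 <= gauss1 t x.
Proof. by rewrite mulr_ge0 ?expR_ge0. Qed.

Lemma measurable_gauss1 t : measurable_fun [set: mR] (gauss1 t).
Proof.
apply: measurable_funM => //; apply: measurableT_comp => //.
by apply: measurableT_comp => //; exact: measurable_funM.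
Qed.

Lemma integral_gauss1 t : 0 < t ->
  (\int[lebesgue_measure]_x (gauss1 t x)%:E = 1)%E.
Proof.
move=> t0; have st0 : 0 < Num.sqrt t by rewrite sqrtr_gt0.
have a0 : 0 < (Num.sqrt t)^-1 by rewrite invr_gt0.
rewrite (@ge0_integral_affine _ _ 0 _ a0); last 2 first.
- by apply/measurable_EFinP; exact: measurable_gauss1.
- by move=> x; rewrite lee_fin gauss1_ge0.
transitivity ((Num.sqrt t)^-1%:E * \int[@lebesgue_measure R]_x
    ((Num.sqrt (t / pi))%:E * (gauss_fun x)%:E))%E.
  congr (_ * _)%E; apply: eq_integral => x _.
  rewrite -EFinM /gauss1 /gauss_fun addr0 exprMn exprVn sqr_sqrtr ?ltW//.
  by rewrite mulrA divff ?mul1r ?gt_eqF.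
rewrite ge0_integralZl//; last 2 first.
- by apply/measurable_EFinP; exact: measurable_gauss_fun.
- by move=> x _; rewrite lee_fin gauss_fun_ge0.
rewrite integralT_gauss -!EFinM sqrtrM ?ltW// sqrtrV ?pi_ge0//.
by rewrite mulrA mulrA mulVf ?mul1r ?mulVf// gt_eqF// sqrtr_gt0 pi_gt0.
Qed.

Definition gauss n t (M : tensor R n) : R := \prod_i gauss1 t (M i).

Lemma gaussE n t (M : tensor R n) :
  gauss t M = Num.sqrt (t / pi) ^+ #|multi_index n| * expR (- (t * tensor_sqnorm M)).
Proof.
rewrite /gauss big_split/= prodr_const; congr (_ * _).
by rewrite -expR_sum sumrN mulr_sumr.
Qed.

Lemma gauss_gt0 n t (M : tensor R n) : 0 < t -> 0 < gauss t M.
Proof.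
by move=> t0; rewrite gaussE mulr_gt0 ?expR_gt0 ?exprn_gt0 ?sqrtr_gt0 ?divr_gt0 ?pi_gt0.
Qed.

Lemma gauss_ge0 n t (M : tensor R n) : 0 <= gauss t M.
Proof. by apply: prodr_ge0 => i _; exact: gauss1_ge0. Qed.

Lemma measurable_gauss n t : measurable_fun setT (@gauss n t).
Proof.
apply: measurable_prod => i _.
exact: (measurableT_comp (measurable_gauss1 t) (measurable_coord i)).
Qed.

Local Open Scope ereal_scope.
Local Notation leb n := (@tensor_lebesgue R K n).

Lemma integral_gauss n t : (0 < t)%R -> \int[leb n]_M (gauss t M)%:E = 1.
Proof.
move=> t0; apply: ge0_integral_tensor_prod; first exact: measurable_gauss1.
  exact: gauss1_ge0.
exact: integral_gauss1.
Qed.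

Lemma integral_gaussZ n t c : (0 < t)%R -> 0 <= c ->
  \int[leb n]_M (c * (gauss t M)%:E) = c.
Proof.
move=> t0 c0; rewrite ge0_integralZl//; last 2 first.
- by apply/measurable_EFinP; exact: measurable_gauss.
- by move=> M _; rewrite lee_fin gauss_ge0.
by rewrite integral_gauss// mule1.
Qed.

Lemma measurable_shear n m (b : multi_index m -> multi_index n -> R)
    d (T : measurableType d) (f : T -> tensor R n) (g : T -> tensor R m) :
  measurable_fun setT f -> measurable_fun setT g ->
  measurable_fun setT (fun x => shear b (f x) (g x)).
Proof.
move=> mf mg; apply: measurable_to_tensor => j; apply: measurable_funD.
  exact: (measurableT_comp (measurable_coord j) mg).
exact: (measurableT_comp (measurable_coord j)
  (measurableT_comp (measurable_tensor_lin b) mf)).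
Qed.

Lemma ge0_integral_shearl n m (b : multi_index m -> multi_index n -> R)
    (F : tensor R m * tensor R n -> \bar R) :
  measurable_fun setT F -> (forall p, 0 <= F p) ->
  \int[leb m \x leb n]_p F (shear b p.2 p.1, p.2) = \int[leb m \x leb n]_p F p.
Proof.
move=> mF F0; rewrite !fubini_tonelli2//; last first.
  apply: (measurableT_comp mF); apply: measurable_fun_pair => //.
  by apply: measurable_shear; [exact: measurable_snd|exact: measurable_fst].
apply: eq_integral => M _.
apply: (@ge0_integral_tensor_shift _ _ _ (fun N => F (N, M)) (tensor_lin b M)) => //.
exact: (measurableT_comp mF (pair2_measurable M)).
Qed.

Lemma ge0_integral_shearr n m (b : multi_index n -> multi_index m -> R)
    (F : tensor R m * tensor R n -> \bar R) :
  measurable_fun setT F -> (forall p, 0 <= F p) ->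
  \int[leb m \x leb n]_p F (p.1, shear b p.1 p.2) = \int[leb m \x leb n]_p F p.
Proof.
move=> mF F0; rewrite !fubini_tonelli1//; last first.
  apply: (measurableT_comp mF); apply: measurable_fun_pair => //.
  by apply: measurable_shear; [exact: measurable_fst|exact: measurable_snd].
apply: eq_integral => N _.
apply: (@ge0_integral_tensor_shift _ _ _ (fun M => F (N, M)) (tensor_lin b N)) => //.
exact: (measurableT_comp mF (pair1_measurable N)).
Qed.

(** Adjoin an independent Gaussian variable N on the target. The block matrix sends (N, M) to a pair
    with first component aM and preserves both Lebesgue measure and the product of the two
    Gaussians. Integrating out N gives the left-hand side, integrating out M the right-hand side. *)
Lemma ge0_integral_coisometry n m (a : multi_index m -> multi_index n -> R) t
    (h : tensor R m -> \bar R) :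
  coisometry a -> (0 < t)%R -> measurable_fun setT h -> (forall M, 0 <= h M) ->
  \int[leb n]_M (h (tensor_lin a M) * (gauss t M)%:E) =
  \int[leb m]_N (h N * (gauss t N)%:E).
Proof.
move=> ca t0 mh h0.
have mg p : measurable_fun setT (fun M : tensor R p => (gauss t M)%:E).
  by apply/measurable_EFinP; exact: measurable_gauss.
have g0 p (M : tensor R p) : 0 <= (gauss t M)%:E by rewrite lee_fin gauss_ge0.
pose H (p : tensor R m * tensor R n) := h p.1 * ((gauss t p.1)%:E * (gauss t p.2)%:E).
have mH : measurable_fun setT H.
  apply: emeasurable_funM; first exact: (measurableT_comp mh measurable_fst).
  apply: emeasurable_funM; first exact: (measurableT_comp (mg m) measurable_fst).
  exact: (measurableT_comp (mg n) measurable_snd).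
have H0 p : 0 <= H p by rewrite !mule_ge0.
pose s1 (p : tensor R m * tensor R n) := (shear a p.2 p.1, p.2).
pose s2 (p : tensor R m * tensor R n) := (p.1, shear (fun i j => - a j i)%R p.1 p.2).
have ms1 : measurable_fun setT s1.
  apply: measurable_fun_pair => //.
  by apply: measurable_shear; [exact: measurable_snd|exact: measurable_fst].
have ms2 : measurable_fun setT s2.
  apply: measurable_fun_pair => //.
  by apply: measurable_shear; [exact: measurable_fst|exact: measurable_snd].
have mH1 : measurable_fun setT (H \o s1) by exact: measurableT_comp.
have mH2 : measurable_fun setT (H \o s1 \o s2) by exact: measurableT_comp.
(* The three shears are removed one at a time; each translates one component by an amount depending
   on the other only. *)
have E : \int[leb m \x leb n]_p (H \o s1 \o s2) (s1 p) = \int[leb m \x leb n]_p H p.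
  rewrite (ge0_integral_shearl a mH2); last by move=> p; exact: H0.
  rewrite (ge0_integral_shearr (fun i j => - a j i)%R mH1); last by move=> p; exact: H0.
  by rewrite (ge0_integral_shearl a mH).
have HE p : (H \o s1 \o s2) (s1 p) =
    h (tensor_lin a p.2) * ((gauss t p.1)%:E * (gauss t p.2)%:E).
  rewrite /H /s1 /s2 /= shear3//; congr (_ * _); rewrite -!EFinM !gaussE; congr EFin.
  rewrite mulrACA [RHS]mulrACA -!expRD; congr (_ * expR _)%R.
  by rewrite -!opprD -!mulrDr sqnorm_shear3.
transitivity (\int[leb m \x leb n]_p H p).
  rewrite -E; under [RHS]eq_integral do rewrite HE.
  rewrite fubini_tonelli2; last 2 first.
  - apply: emeasurable_funM.
      exact: (measurableT_comp mh
        (measurableT_comp (measurable_tensor_lin a) measurable_snd)).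
    apply: emeasurable_funM; first exact: (measurableT_comp (mg m) measurable_fst).
    exact: (measurableT_comp (mg n) measurable_snd).
  - by move=> p; rewrite !mule_ge0.
  apply: eq_integral => M _; rewrite /fubini_G/=.
  under eq_integral do rewrite muleCA muleC.
  by rewrite integral_gaussZ// mule_ge0.
rewrite fubini_tonelli1//; apply: eq_integral => N _; rewrite /fubini_F /H/=.
under eq_integral do rewrite muleA.
by rewrite integral_gaussZ// mule_ge0.
Qed.

(** Lebesgue invariance follows from Gaussian invariance: divide [h] by the positive Gaussian
    density, whose value does not change under [a] because the transpose is a coisometry too. *)
Lemma ge0_integral_orthogonal n (a : multi_index n -> multi_index n -> R)
    (h : tensor R n -> \bar R) :
  coisometry a -> coisometry (fun i j => a j i) ->
  measurable_fun setT h -> (forall M, 0 <= h M) ->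
  \int[leb n]_M h (tensor_lin a M) = \int[leb n]_M h M.
Proof.
move=> ca ca' mh h0.
pose k (M : tensor R n) := h M * ((gauss 1 M)^-1)%:E.
have := @ge0_integral_coisometry n n a 1 k ca ltr01.
have gN (M : tensor R n) : gauss 1 M != 0%R by rewrite gt_eqF// gauss_gt0.
have -> : (fun M => k (tensor_lin a M) * (gauss 1 M)%:E) = (fun M => h (tensor_lin a M)).
  apply/funext => M; rewrite /k -muleA -EFinM (_ : gauss 1 (tensor_lin a M) = gauss 1 M).
    by rewrite mulVf// mule1.
  by rewrite !gaussE (sqnorm_tensor_lin_adj _ ca').
have -> : (fun M => k M * (gauss 1 M)%:E) = h.
  by apply/funext => M; rewrite /k -muleA -EFinM mulVf// mule1.
apply.
- apply: emeasurable_funM => //; apply/measurable_EFinP.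
  under eq_fun do rewrite gaussE invfM -expRN opprK.
  apply: measurable_funM => //; apply: measurableT_comp => //.
  by apply: measurable_funM => //; exact: measurable_tensor_sqnorm.
- by move=> M; rewrite mule_ge0// lee_fin invr_ge0 gauss_ge0.
Qed.

End gaussian.

(** * Spectral theorem for real symmetric matrices *)

Section real_spectral.
Context {R : rcfType}.
Import complex.

Lemma rv_dot_ge0 n (v : 'rV[R]_n) : 0 <= (v *m v^T) 0 0.
Proof. by rewrite mxE; apply: sumr_ge0 => i _; rewrite mxE -expr2 sqr_ge0. Qed.

Lemma rv_dot_eq0 n (v : 'rV[R]_n) : (v *m v^T) 0 0 = 0 -> v = 0.
Proof.
rewrite mxE => /eqP; rewrite psumr_eq0; last first.
  by move=> i _; rewrite mxE -expr2 sqr_ge0.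
move=> /allP v0; apply/rowP => i; rewrite !mxE.
by have := v0 i (mem_index_enum i); rewrite mxE mulf_eq0 orbb => /eqP.
Qed.

Lemma rv_dot_gt0 n (v : 'rV[R]_n) : v != 0 -> 0 < (v *m v^T) 0 0.
Proof.
move=> v0; rewrite lt_neqAle rv_dot_ge0 andbT eq_sym.
by apply: contra v0 => /eqP/rv_dot_eq0 ->.
Qed.

(** Over the algebraically closed field [R[i]] an eigenvector w = a + ib exists. Once its eigenvalue
    is known to be real, [a] and [b] both satisfy the eigenvector equation over [R], and one of them
    is nonzero. *)
Lemma symmetric_eigenvector n (S : 'M[R]_n.+1) : S^T = S ->
  exists (l : R) (v : 'rV_n.+1), v != 0 /\ v *m S = l *: v.
Proof.
move=> symS; pose S' : 'M[R[i]]_n.+1 := map_mx (real_complex R) S.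
have [z /eigenvalueP[w wS w0]] := eigenvalue_closed S' isT.
pose a : 'rV[R]_n.+1 := map_mx (@Re R) w; pose b : 'rV[R]_n.+1 := map_mx (@Im R) w.
have aS : a *m S = Re z *: a - Im z *: b.
  apply/rowP => j; have /rowP/(_ j)/(congr1 (@Re R)) := wS.
  rewrite !mxE raddf_sum => h; transitivity (Re (z * w 0 j)); last first.
    by case: (z) (w 0 j) => [? ?] [].
  rewrite -h; apply: eq_bigr => i _; rewrite !mxE; case: (w 0 i) => x y /=.
  by rewrite mulr0 subr0.
have bS : b *m S = Re z *: b + Im z *: a.
  apply/rowP => j; have /rowP/(_ j)/(congr1 (@Im R)) := wS.
  rewrite !mxE raddf_sum => h; transitivity (Im (z * w 0 j)); last first.
    by case: (z) (w 0 j) => [? ?] [].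
  rewrite -h; apply: eq_bigr => i _; rewrite !mxE; case: (w 0 i) => x y /=.
  by rewrite mulr0 add0r.
have ab0 : a != 0 \/ b != 0.
  have [a0|] := eqVneq a 0; last by left.
  right; apply: contra w0 => /eqP b0; apply/eqP/rowP => j.
  move/rowP/(_ j): a0; move/rowP/(_ j): b0; rewrite !mxE.
  by case: (w 0 j) => x y /= -> ->.
have tr11 (A : 'M[R]_1) : A 0 0 = A^T 0 0 by rewrite mxE.
have dotC (x y : 'rV[R]_n.+1) : (x *m y^T) 0 0 = (y *m x^T) 0 0.
  by rewrite [LHS]tr11 trmx_mul trmxK.
have abS : (a *m S *m b^T) 0 0 = (b *m S *m a^T) 0 0.
  by rewrite [LHS]tr11 !trmx_mul trmxK symS mulmxA.
(* Comparing a S b^T with b S a^T gives Im z (|a|^2 + |b|^2) = 0. *)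
have yz0 : Im z = 0.
  have DB (k l : R) (x y u : 'rV[R]_n.+1) : ((k *: x + l *: y) *m u^T) 0 0 =
      k * (x *m u^T) 0 0 + l * (y *m u^T) 0 0.
    by rewrite mulmxDl -!scalemxAl !mxE.
  move: abS; rewrite aS bS -scaleNr !DB (dotC b a) => /addrI/eqP.
  rewrite mulNr eq_sym -addr_eq0 -mulrDr mulf_eq0 => /orP[/eqP//|].
  case: ab0 => /rv_dot_gt0 ?; rewrite gt_eqF//.
    by rewrite ltr_wpDr// rv_dot_ge0.
  by rewrite ltr_wpDl// rv_dot_ge0.
move: aS bS; rewrite yz0 !scale0r subr0 addr0 => aS bS.
by case: ab0 => [a0|b0]; [exists (Re z), a|exists (Re z), b].
Qed.

(** For distinct unit vectors, H is the reflection in the hyperplane orthogonal to e - v, which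
    exchanges [e] and [v]. *)
Lemma householder n (e v : 'rV[R]_n) :
  (e *m e^T) 0 0 = 1 -> (v *m v^T) 0 0 = 1 ->
  exists H : 'M[R]_n, H^T = H /\ H *m H = 1%:M /\ e *m H = v.
Proof.
move=> ee vv; have [->|ev] := eqVneq e v.
  by exists 1%:M; rewrite trmx1 !mulmx1.
have [u uE] : exists u, u = e - v by exists (e - v).
pose c := (u *m u^T) 0 0.
have c0 : c != 0 by rewrite gt_eqF// rv_dot_gt0// uE subr_eq0.
have M11 (A : 'M[R]_1) : A = (A 0 0)%:M by rewrite [LHS]mx11_scalar.
have uu : u *m u^T = c%:M by rewrite [LHS]M11.
exists (1%:M - (2 / c) *: (u^T *m u)); split; [|split].
- by rewrite linearB/= linearZ/= trmx_mul trmxK trmx1.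
- rewrite mulmxBl mul1mx mulmxBr mulmx1 -scalemxAl -scalemxAr mulmxA.
  rewrite -(mulmxA _ u) uu mul_mx_scalar -scalemxAl !scalerA.
  rewrite -[RHS]addr0 -addrA; congr (_ + _).
  rewrite opprB -scalerBl -scaleNr -scalerDl -[RHS](scale0r (u^T *m u)).
  by congr (_ *: _); field.
- have tr11 (A : 'M[R]_1) : A 0 0 = A^T 0 0 by rewrite mxE.
  (* For unit vectors, c = |e - v|^2 = 2 - 2 <e, v>, while <e, u> = 1 - <e, v>. *)
  have eu : e *m u^T = (c / 2)%:M.
    rewrite [LHS]M11; congr (_%:M); rewrite /c uE linearB/= !mulmxBr !mulmxBl.
    have D11 (A B : 'M[R]_1) : (A - B) 0 0 = A 0 0 - B 0 0 by rewrite !mxE.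
    rewrite !D11 ee vv.
    have -> : (v *m e^T) 0 0 = (e *m v^T) 0 0 by rewrite [LHS]tr11 trmx_mul trmxK.
    by field.
  rewrite mulmxBr mulmx1 -scalemxAr mulmxA eu mul_scalar_mx scalerA.
  by rewrite mulrA divfK// divff// scale1r uE opprB addrC subrK.
Qed.

(** Deflation: a reflection [H] moves a unit eigenvector [v] to the first basis vector, so the first
    row of H S H is (l, 0, ..., 0). By symmetry so is its first column, and the induction hypothesis
    applies to the remaining block. *)
Lemma symmetric_diagonalization n (S : 'M[R]_n) : S^T = S ->
  exists (P : 'M[R]_n) (d : 'rV[R]_n),
    P *m P^T = 1%:M /\ S = P^T *m diag_mx d *m P.
Proof.
elim: n S => [|n IH] S symS.
  by exists 0, 0; rewrite !flatmx0; split=> //; exact: flatmx0.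
have [l [v0 [v0_neq0 v0S]]] := symmetric_eigenvector symS.
pose v := (Num.sqrt ((v0 *m v0^T) 0 0))^-1 *: v0.
have vv : (v *m v^T) 0 0 = 1.
  rewrite /v linearZ/= -scalemxAl -scalemxAr scalerA mxE.
  have s0 := rv_dot_gt0 v0_neq0.
  by rewrite -invfM -expr2 sqr_sqrtr ?(ltW s0)// mulVf// gt_eqF.
have vS : v *m S = l *: v.
  by rewrite /v -scalemxAl v0S !scalerA mulrC.
pose e : 'rV[R]_(1 + n) := delta_mx 0 0.
have [H [symH [HH eH]]] :
    exists H : 'M[R]_(1 + n), H^T = H /\ H *m H = 1%:M /\ e *m H = v.
  by apply: householder => //; rewrite trmx_delta mul_delta_mx mxE.
have vH : v *m H = e by rewrite -eH -mulmxA HH mulmx1.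
have [B Bdef] : exists B : 'M[R]_(1 + n), B = H *m S *m H by exists (H *m S *m H).
have symB : B^T = B by rewrite Bdef !trmx_mul symH symS mulmxA.
have eB : e *m B = l *: e by rewrite Bdef !mulmxA eH vS -scalemxAl vH.
have B0 j : B 0 j = l * (j == 0)%:R.
  by have /rowP/(_ j) := eB; rewrite /e -rowE !mxE eqxx.
have BE : B = block_mx l%:M 0 0 (drsubmx B).
  rewrite -[LHS]submxK; congr block_mx; apply/matrixP => i j.
  - by rewrite !mxE !ord1 lshift0 B0 mulr1.
  - by rewrite !mxE !ord1 lshift0 B0 mulr0.
  - by rewrite -[B in LHS]symB !mxE !ord1 lshift0 B0 mulr0.
have symD : (drsubmx B)^T = drsubmx B by rewrite trmx_drsub symB.
have [P' [d' [PP' DE]]] := IH _ symD.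
pose Q := block_mx 1%:M 0 0 P' : 'M[R]_(1 + n).
have trQ : Q^T = block_mx 1%:M 0 0 P'^T :> 'M[R]_(1 + n).
  by rewrite /Q (@tr_block_mx _ 1 n 1 n) !trmx0 trmx1.
have QQ : Q *m Q^T = 1%:M :> 'M[R]_(1 + n).
  rewrite trQ /Q (@mulmx_block _ 1 n 1 n) !mulmx0 !mul0mx !mulmx1 !addr0 add0r PP'.
  by rewrite -(@scalar_mx_block _ 1 n).
have QDQ : Q^T *m (block_mx (diag_mx l%:M) 0 0 (diag_mx d') *m Q) = B :> 'M[R]_(1 + n).
  rewrite trQ BE /Q !(@mulmx_block _ 1 n 1 n).
  rewrite !mulmx0 !mul0mx !mulmx1 !mul1mx !addr0 !add0r mulmx0 mulmxA -DE.
  by congr block_mx; apply/matrixP => i j; rewrite !mxE !ord1.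
have dE : diag_mx (row_mx l%:M d') =
    block_mx (diag_mx l%:M) 0 0 (diag_mx d') :> 'M[R]_(1 + n).
  exact: diag_mx_row.
exists (Q *m H), (row_mx l%:M d'); split.
  by rewrite trmx_mul symH mulmxA -(mulmxA Q) HH mulmx1 QQ.
rewrite trmx_mul symH dE.
transitivity (H *m (Q^T *m (block_mx (diag_mx l%:M) 0 0 (diag_mx d') *m Q)) *m H).
  by rewrite QDQ Bdef !mulmxA HH mul1mx -mulmxA HH mulmx1.
by rewrite !mulmxA.
Qed.

End real_spectral.

(** * The Gamma mixture *)

Section gamma.
Context {R : realType}.
Local Notation mR := (measurableTypeR R).
Local Notation leb := (@lebesgue_measure R).
Implicit Types p a q nu s x : R.

Definition gamma_fun p a x : R := x `^ (p - 1) * expR (- (a * x)).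

Lemma gamma_fun_ge0 p a x : 0 <= gamma_fun p a x.
Proof. by rewrite mulr_ge0 ?powR_ge0 ?expR_ge0. Qed.

Lemma measurable_gamma_fun p a : measurable_fun [set: mR] (gamma_fun p a).
Proof.
apply: measurable_funM; first exact: measurable_powR.
by apply: measurableT_comp => //; apply: measurableT_comp => //; exact: measurable_funM.
Qed.

(** The inequality ln y <= y - 1 at y = x / (2(p - 1)) bounds (p - 1) ln x by a constant plus x / 2,
    which uses up half of the exponential decay. The leading 2 in [C] cancels the normalization of
    the exponential density of rate 1/2. *)
Lemma gamma_fun_le p : 1 < p ->
  exists2 C : R, 0 < C &
    forall x, 0 < x -> gamma_fun p 1 x <= C * exponential_pdf 2^-1 x.
Proof.
move=> p1; have c0 : 0 < 2 * (p - 1) by lra.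
exists (2 * expR ((p - 1) * ln (2 * (p - 1)))); first by rewrite mulr_gt0 ?expR_gt0.
move=> x x0; rewrite exponential_pdfE ?(ltW x0)//.
rewrite mulrACA divff ?mul1r// -expRD /gamma_fun /powR gt_eqF// -expRD ler_expR.
have y0 : 0 < x / (2 * (p - 1)) by rewrite divr_gt0.
have : ln (x / (2 * (p - 1))) <= x / (2 * (p - 1)) - 1.
  by rewrite -[X in ln X](subrK 1) addrC; apply: le_ln1Dx; lra.
rewrite ln_div ?posrE// => lnx.
have {}lnx : ln x <= ln (2 * (p - 1)) + x / (2 * (p - 1)) by lra.
have p0 : 0 < p - 1 by lra.
have : (p - 1) * ln x <= (p - 1) * (ln (2 * (p - 1)) + x / (2 * (p - 1))).
  by rewrite ler_wpM2l// ltW.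
rewrite mulrDr (_ : (p - 1) * (x / (2 * (p - 1))) = x / 2); last first.
  by field; rewrite gt_eqF.
lra.
Qed.

Local Open Scope ereal_scope.

Lemma integral_gamma_fun_fin p : (1 < p)%R ->
  \int[leb]_(x in `]0%R, +oo[) (gamma_fun p 1 x)%:E \is a fin_num.
Proof.
move=> /gamma_fun_le[C C0 le].
rewrite ge0_fin_numE; last by apply: integral_ge0 => x _; rewrite lee_fin gamma_fun_ge0.
have me : measurable_fun [set: mR] (exponential_pdf (2^-1 : R)).
  by apply: measurable_exponential_pdf.
have e0 (x : R) : (0 <= exponential_pdf (2^-1 : R) x)%R.
  by apply: exponential_pdf_ge0.
apply: (@le_lt_trans _ _
  (\int[leb]_(x in `]0%R, +oo[) (C%:E * (exponential_pdf 2^-1 x)%:E))).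
  apply: ge0_le_integral => //.
  - by move=> x _; rewrite lee_fin gamma_fun_ge0.
  - by apply/measurable_EFinP/measurable_funTS; exact: measurable_gamma_fun.
  - by apply/measurable_funTS/measurable_EFinP; exact: measurable_funM.
  - by move=> x/=; rewrite in_itv/= andbT => x0; rewrite -EFinM lee_fin le.
apply: (@le_lt_trans _ _ (\int[leb]_x (C%:E * (exponential_pdf 2^-1 x)%:E))).
  apply: ge0_subset_integral => //; last first.
    by move=> x _; rewrite -EFinM lee_fin mulr_ge0// ltW.
  by apply/measurable_EFinP; exact: measurable_funM.
rewrite ge0_integralZl//; [|exact/measurable_EFinP
  |by move=> x _; rewrite lee_fin|by rewrite lee_fin ltW].
by rewrite integral_exponential_pdf// mule1 ltry.
Qed.

(** [Gamma] is the [fine] part of an extended integral, hence would be 0 if that integral were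
    infinite; finiteness makes the two agree. The range p > 1 covers the arguments in use, nu / 2
    and (N + nu) / 2. *)
Lemma GammaE p : (1 < p)%R ->
  (Gamma p)%:E = \int[leb]_(x in `]0%R, +oo[) (gamma_fun p 1 x)%:E.
Proof.
move=> p1; rewrite -(fineK (integral_gamma_fun_fin p1)); congr EFin.
rewrite /Gamma /Rintegral; congr fine.
by apply: eq_integral => x _; rewrite /gamma_fun mul1r.
Qed.

Lemma Gamma_gt0 p : (1 < p)%R -> (0 < Gamma p)%R.
Proof.
move=> p1; rewrite -lte_fin GammaE//.
(* On [1, 2] the power is at least 1 and the exponential at least exp(-2). *)
apply: (@lt_le_trans _ _ (\int[leb]_(x in `[1%R, 2%R]) (expR (- 2))%:E)).
  rewrite integral_cst//= lebesgue_measure_itv/= lte_fin ltr1n -EFinB -EFinM lte_fin.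
  by rewrite mulr_gt0 ?expR_gt0//; lra.
apply: (@le_trans _ _ (\int[leb]_(x in `[1%R, 2%R]) (gamma_fun p 1 x)%:E)).
  apply: ge0_le_integral => //.
  - by apply/measurable_EFinP/measurable_funTS; exact: measurable_gamma_fun.
  - move=> x/=; rewrite in_itv/= => /andP[x1 x2]; rewrite lee_fin /gamma_fun.
    rewrite -[leLHS]mul1r ler_pM ?expR_ge0 ?ler_expR//; last by rewrite mul1r lerN2.
    have /(ler_powR x1) : (0 <= p - 1)%R by lra.
    by rewrite powRr0.
apply: ge0_subset_integral => //.
- by apply/measurable_EFinP/measurable_funTS; exact: measurable_gamma_fun.
- by move=> x _; rewrite lee_fin gamma_fun_ge0.
- by move=> x/=; rewrite !in_itv/= andbT => /andP[x1 _]; rewrite (lt_le_trans _ x1).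
Qed.

Lemma integral_gamma_fun p a : (1 < p)%R -> (0 < a)%R ->
  \int[leb]_(x in `]0%R, +oo[) (gamma_fun p a x)%:E = (a `^ (- p) * Gamma p)%:E.
Proof.
move=> p1 a0; rewrite EFinM GammaE// integral_mkcond [in RHS]integral_mkcond.
have mg b : measurable_fun [set: mR] (fun x => (gamma_fun p b x)%:E).
  by apply/measurable_EFinP; exact: measurable_gamma_fun.
have ai : (0 < a^-1)%R by rewrite invr_gt0.
rewrite (@ge0_integral_affine _ a^-1 0); last 3 first.
- by [].
- by apply/(measurable_restrictT _ _).1 => //; exact: measurable_funTS.
- by move=> x; apply: erestrict_ge0 => y _; rewrite lee_fin gamma_fun_ge0.
(* The substitution x -> x / a contributes 1/a, and the power (x / a)^(p - 1) contributes a^(1 -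
   p). *)
have -> : (a `^ (- p) = a^-1 * a `^ (1 - p))%R.
  rewrite -(powR_inv1 (ltW a0)) -powRD; last by rewrite (gt_eqF a0) implybT.
  by congr powR; lra.
rewrite EFinM -muleA; congr *%E.
rewrite -ge0_integralZl//; last 3 first.
- by apply/(measurable_restrictT _ _).1 => //; exact: measurable_funTS.
- by move=> x _; apply: erestrict_ge0 => y _; rewrite lee_fin gamma_fun_ge0.
- by rewrite lee_fin powR_ge0.
apply: eq_integral => x _; rewrite /patch !mem_setE !in_itv/= !andbT addr0.
rewrite pmulr_rgt0//; case: ifPn => [x0|_]; last by rewrite mule0.
rewrite -EFinM; congr EFin; rewrite /gamma_fun.
rewrite (powRM _ (ltW ai) (ltW x0)) (mulrA a) divff ?(gt_eqF a0)// mulrA.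
by congr (_ * _ * _)%R; rewrite -powR_inv1 ?(ltW a0)// -powRrM mulN1r opprB.
Qed.

(** Up to the constant (nu pi)^(-N/2), the integrand is a Gamma integrand of shape (N + nu) / 2 and
    rate 1 + q / nu: the Gaussian normalization supplies s^(N/2), its exponent the additional
    rate. *)
Lemma t_mixture nu q N : (2 < nu)%R -> (0 <= q)%R ->
  \int[leb]_(s in `]0%R, +oo[) (gamma_fun (nu / 2) 1 s *
     (Num.sqrt (s / nu / pi) ^+ N * expR (- (s / nu * q))))%:E =
  (Gamma ((N%:R + nu) / 2) / (nu * pi) `^ (N%:R / 2) *
     (1 + nu^-1 * q) `^ (- ((N%:R + nu) / 2)))%:E.
Proof.
move=> nu2 q0; have nu0 : (0 < nu)%R by lra.
have N0 : (0 <= N%:R :> R)%R by rewrite ler0n.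
have a0 : (0 < 1 + nu^-1 * q)%R.
  by rewrite ltr_pwDl// mulr_ge0// invr_ge0 ltW.
have p1 : (1 < (N%:R + nu) / 2)%R by lra.
have np : (0 < nu * pi)%R by rewrite mulr_gt0// pi_gt0.
rewrite (_ : (Gamma _ / _ * _)%R = (((nu * pi) `^ (N%:R / 2))^-1 *
  ((1 + nu^-1 * q) `^ (- ((N%:R + nu) / 2)) * Gamma ((N%:R + nu) / 2)))%R);
  last by ring.
rewrite EFinM -integral_gamma_fun//.
rewrite -ge0_integralZl//; last 3 first.
- by apply/measurable_EFinP/measurable_funTS; exact: measurable_gamma_fun.
- by move=> x _; rewrite lee_fin gamma_fun_ge0.
- by rewrite lee_fin invr_ge0 powR_ge0.
apply: eq_integral => s; rewrite mem_setE in_itv/= andbT => s0.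
rewrite -EFinM; congr EFin.
have -> : (Num.sqrt (s / nu / pi) ^+ N = s `^ (N%:R / 2) / (nu * pi) `^ (N%:R / 2))%R.
  rewrite -powR_mulrn ?sqrtr_ge0// -powR12_sqrt; last first.
    by rewrite !divr_ge0 ?pi_ge0// ltW.
  rewrite -powRrM -mulrA -invfM powRM ?invr_ge0 ?ltW//.
  rewrite -(powR_inv1 (ltW np)) -powRrM mulN1r powRN (mulrC 2^-1)%R//.
rewrite /gamma_fun.
have -> : ((N%:R + nu) / 2 - 1 = (nu / 2 - 1) + N%:R / 2)%R by lra.
rewrite (@powRD _ s (nu / 2 - 1) (N%:R / 2)); last by rewrite (gt_eqF s0) implybT.
have -> : (- ((1 + nu^-1 * q) * s) = - (1 * s) + - (s / nu * q))%R by ring.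
rewrite expRD.
move: (s `^ _)%R (expR _) (s `^ _)%R (expR _) ((nu * pi) `^ _)^-1%R => u v w z y.
ring.
Qed.

End gamma.

(** * Mode products as Kronecker products *)

Section multilinear.
Context {R : realType} {K : nat}.
Implicit Types n m : 'I_K -> nat.

(* Entries indexed by natural numbers, so that no transport is needed between
   the ordinal types of the intermediate shapes. *)
Let entry p q (A : 'M[R]_(p, q)) (a b : nat) : R :=
  if (insub a, insub b) is (Some i, Some j) then A i j else 0.

Let entryE p q (A : 'M[R]_(p, q)) (i : 'I_p) (j : 'I_q) : entry A i j = A i j.
Proof. by rewrite /entry !valK. Qed.

Let conform_entry p q p' q' (B : 'M[R]_(p', q')) (A : 'M[R]_(p, q))
    (i : 'I_p') (j : 'I_q') :
  p = p' -> q = q' -> conform_mx B A i j = entry A i j.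
Proof. by move=> ep eq; subst p' q'; rewrite conform_mx_id entryE. Qed.

Let replace_in n m (ks : seq 'I_K) (k : 'I_K) :
  k \in ks -> replace_modes n m ks k = m k.
Proof. by rewrite /replace_modes => ->. Qed.

Let replace_notin n m (ks : seq 'I_K) (k : 'I_K) :
  k \notin ks -> replace_modes n m ks k = n k.
Proof. by rewrite /replace_modes => /negbTE ->. Qed.

(** Since [ks] has no duplicates, mode [k] still has its original size when [A k] is applied, so
    [conform_mx] never takes its default value. Exchanging the two sums leaves one intermediate
    index for each [i]. *)
Let mode_prodsE n m (W : tensor R n) (A : forall k, 'M[R]_(m k, n k))
    (ks : seq 'I_K) (j : multi_index (replace_modes n m ks)) :
  uniq ks -> @mode_prods R K n m W A ks j =
  \sum_(i : multi_index n | [forall l, (l \notin ks) ==> (i l == j l :> nat)])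
    W i * \prod_(k <- ks) entry (A k) (j k) (i k).
Proof.
elim: ks j => [|k ks IH] j.
  move=> _ /=; rewrite (big_pred1 j) ?big_nil ?mulr1// => i /=.
  apply/forallP/eqP => [ij|-> l]; last exact: eqxx.
  by apply/ffunP => l; apply/val_inj/eqP; exact: ij.
move=> /andP[kks uks].
transitivity (\sum_(i' : multi_index (replace_modes n m ks)
    | [forall l, (l != k) ==> (i' l == j l :> nat)])
  @mode_prods R K n m W A ks i' * (conform_mx 0 (A k) :
    'M[R]_(replace_modes n m (k :: ks) k, replace_modes n m ks k)) (j k) (i' k)).
  by [].
under eq_bigr => i' _.
  rewrite IH// conform_entry; last 2 first.
  - by rewrite replace_in// mem_head.
  - by rewrite replace_notin.
  rewrite mulr_suml.
  over.
rewrite (exchange_big_dep (fun i : multi_index n =>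
  [forall l, (l \notin k :: ks) ==> (i l == j l :> nat)]))/=; last first.
  move=> i' i /forallP i'j /forallP ii'; apply/forallP => l; apply/implyP.
  rewrite in_cons negb_or => /andP[lk lks].
  by have := ii' l; have := i'j l; rewrite lk lks/= => /eqP <-.
apply: eq_bigr => i /forallP ij.
have lt l : ((if l == k then i k : nat else j l) < replace_modes n m ks l)%N.
  have [->|lk] := eqVneq l k; first by rewrite replace_notin.
  by apply: leq_trans (ltn_ord (j l)) _; rewrite /replace_modes in_cons (negbTE lk).
(* The only compatible intermediate index: mode [k] has not been contracted yet and carries the
   index of [i]; every other mode agrees with [j]. *)
pose i0 : multi_index (replace_modes n m ks) := [ffun l => Ordinal (lt l)].
have i0E l : i0 l = (if l == k then i k : nat else j l) :> nat by rewrite ffunE.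
rewrite (big_pred1 i0) => [|i' /=]; last first.
  apply/andP/eqP => [[/forallP i'j /forallP ii']|->].
    apply/ffunP => l; apply/val_inj; rewrite /= i0E.
    have [->|lk] := eqVneq l k.
      by have := ii' k; rewrite kks/= => /eqP.
    by have := i'j l; rewrite lk/= => /eqP.
  split; apply/forallP => l; apply/implyP; rewrite i0E.
    by move=> /negbTE ->.
  have [->//|lk lks] := eqVneq l k.
  by have := ij l; rewrite in_cons negb_or lk lks.
rewrite big_cons i0E eqxx -mulrA (mulrC (entry _ _ _)); congr (_ * (_ * _)).
apply: eq_big_seq => l lks; rewrite i0E ifN//.
by apply: contraNneq kks => <-.
Qed.

Definition kron n m (A : forall k, 'M[R]_(m k, n k)) (j : multi_index m)
  (i : multi_index n) : R := \prod_k A k (j k) (i k).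

Lemma multilinear_prodE n m (W : tensor R n) (A : forall k, 'M[R]_(m k, n k)) :
  multilinear_prod W A = tensor_lin (kron A) W.
Proof.
apply/funext => j; rewrite /multilinear_prod mode_prodsE ?rev_uniq ?enum_uniq//.
rewrite /tensor_lin; apply: eq_big => [i|i _].
  by apply/forallP => l; rewrite mem_rev mem_enum.
congr (_ * _); rewrite big_rev big_enum; apply: eq_bigr => k _.
by rewrite ffunE/= entryE.
Qed.

(** Distributivity of a product over sums whose ranges depend on [k]; [fprod] presents multi-indices
    as choice functions into the tagged union of the ranges. *)
Lemma sum_multi_index_prod n (F : forall k, 'I_(n k) -> R) :
  \sum_(i : multi_index n) \prod_k F k (i k) = \prod_k \sum_(l < n k) F k l.
Proof.
pose F' k : {ffun 'I_(n k) -> R} := [ffun l => F k l].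
transitivity (\sum_(t : fprod (fun k => 'I_(n k))) \prod_(k in 'I_K) F' k (t k)).
  rewrite (reindex (@fprod_of_dffun _ (fun k : 'I_K => 'I_(n k)))) /=; last first.
    exact/onW_bij/fprod_of_dffun_bij.
  apply: eq_bigr => i _; apply: eq_bigr => k _.
  by rewrite fprodE ffunE.
rewrite big_fprod/=.
under [RHS]eq_bigr => k _.
  rewrite (_ : \sum_(l < n k) F k l = \sum_(l < n k) F' k l); last first.
    by apply: eq_bigr => l _; rewrite ffunE.
  rewrite (big_tag (fun k l => F' k l)).
  over.
by rewrite bigA_distr_big_dep.
Qed.

(** The mixed-product rule for Kronecker products, by which matrix identities can be checked mode by
    mode. *)
Lemma kron_mul n m (p : 'I_K -> nat) (A : forall k, 'M[R]_(m k, n k))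
    (B : forall k, 'M[R]_(p k, m k)) l i :
  \sum_j kron B l j * kron A j i = kron (fun k => B k *m A k) l i.
Proof.
transitivity (\sum_(j : multi_index m) \prod_k (B k (l k) (j k) * A k (j k) (i k))).
  by apply: eq_bigr => j _; rewrite big_split.
rewrite (@sum_multi_index_prod m (fun k j => B k (l k) j * A k j (i k))).
by apply: eq_bigr => k _; rewrite mxE.
Qed.

Lemma kron1 n : kron (fun k => 1%:M : 'M[R]_(n k)) = fun j i => (j == i)%:R.
Proof.
apply/funext => j; apply/funext => i; rewrite /kron.
have [->|/eqP ji] := eqVneq j i; first by rewrite big1// => k _; rewrite mxE eqxx.
have [k jk] : exists k, j k != i k.
  apply/existsP; rewrite -negb_forall; apply/negP => /forallP e.
  by apply: ji; apply/ffunP => k; apply/eqP.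
by rewrite (bigD1 k)//= mxE (negbTE jk) mul0r.
Qed.

Lemma tensor_lin_kron_comp n m (p : 'I_K -> nat) (A : forall k, 'M[R]_(m k, n k))
    (B : forall k, 'M[R]_(p k, m k)) M :
  tensor_lin (kron B) (tensor_lin (kron A) M) =
  tensor_lin (kron (fun k => B k *m A k)) M.
Proof.
rewrite tensor_lin_comp; congr tensor_lin.
by apply/funext => l; apply/funext => i; rewrite kron_mul.
Qed.

Lemma kron_tr n m (A : forall k, 'M[R]_(m k, n k)) :
  (fun i j => kron A j i) = kron (fun k => (A k)^T).
Proof.
by apply/funext => i; apply/funext => j; apply: eq_bigr => k _; rewrite mxE.
Qed.

Lemma coisometry_kron n m (A : forall k, 'M[R]_(m k, n k)) :
  (forall k, A k *m (A k)^T = 1%:M) -> coisometry (kron A).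
Proof.
move=> AA j l.
under eq_bigr do rewrite -[kron A l _]/((fun i j => kron A j i) _ _) kron_tr.
rewrite kron_mul (_ : (fun k => _) = (fun k => 1%:M)) ?kron1//.
by apply: functional_extensionality_dep => k.
Qed.

End multilinear.

(** * Positive definite covariance matrices *)

Section posdef.
Context {R : realType}.

Lemma posdef_diagonalization n (S : 'M[R]_n) : posdefmx S ->
  exists (P : 'M[R]_n) (d : 'rV[R]_n),
  [/\ P *m P^T = 1%:M, P^T *m P = 1%:M, S = P^T *m diag_mx d *m P &
      forall i, 0 < d 0 i].
Proof.
move=> [symS posS]; have [P [d [PP SE]]] := symmetric_diagonalization symS.
exists P, d; split=> //; first exact: mulmx1C.
(* The entry d_i is the value of the quadratic form of [S] at row i of [P], which is nonzero because
   P P^T = 1. *)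
move=> i; have Pi0 : row i P != 0.
  apply: contra_eq_neq (PP) => Pi0; apply/eqP => /matrixP/(_ i i).
  rewrite !mxE eqxx big1 => [/esym/eqP|j _]; first by rewrite oner_eq0.
  by move/rowP/(_ j) : Pi0; rewrite !mxE => ->; rewrite mul0r.
have := posS _ Pi0; rewrite SE rowE !trmx_mul !mulmxA -(mulmxA _ P) PP mulmx1.
rewrite -(mulmxA _ P) PP mulmx1 -rowE row_diag_mx -scalemxAl trmx_delta.
by rewrite mul_delta_mx !mxE !eqxx mulr1.
Qed.

Lemma posdef_diag n (P : 'M[R]_n) (d : 'rV[R]_n) : P^T *m P = 1%:M ->
  (forall i, 0 < d 0 i) -> posdefmx (P^T *m diag_mx d *m P).
Proof.
move=> PP d0; split; first by rewrite !trmx_mul trmxK tr_diag_mx mulmxA.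
move=> x x0; have [y yE] : exists y, y = x *m P^T by exists (x *m P^T).
have yj : exists j, y 0 j != 0.
  apply/existsP; apply: contraNT x0 => /existsPn y0.
  have -> : x = y *m P by rewrite yE -mulmxA PP mulmx1.
  rewrite (_ : y = 0) ?mul0mx//; apply/rowP => j.
  by have := y0 j; rewrite negbK => /eqP ->; rewrite mxE.
have -> : x *m (P^T *m diag_mx d *m P) *m x^T = y *m diag_mx d *m y^T.
  by rewrite yE trmx_mul trmxK !mulmxA.
rewrite mul_mx_diag mxE; case: yj => j yj.
rewrite (bigD1 j)//= ltr_wpDr//.
  apply: sumr_ge0 => i _; rewrite !mxE mulrAC mulr_ge0 ?(ltW (d0 i))//.
  by rewrite -expr2 sqr_ge0.
by rewrite !mxE mulrAC mulr_gt0// -expr2 exprn_even_gt0.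
Qed.

Lemma posdef_unit n (S : 'M[R]_n) : posdefmx S -> S \in unitmx.
Proof.
move=> [_ pS]; rewrite -row_free_unit -kermx_eq0; apply/rowV0P => x /sub_kermxP xS.
by apply/eqP; apply: contraT => /pS; rewrite xS mul0mx mxE ltxx.
Qed.

Lemma posdef_det_gt0 n (S : 'M[R]_n) : posdefmx S -> 0 < \det S.
Proof.
move=> /posdef_diagonalization[P [d [PP PP' -> d0]]].
rewrite !det_mulmx mulrAC -det_mulmx PP' det1 mul1r det_diag.
exact: prodr_gt0.
Qed.

Lemma posdefmx1 n : posdefmx (1%:M : 'M[R]_n).
Proof.
split=> [|x x0]; first by rewrite trmx1.
by rewrite mulmx1; exact: rv_dot_gt0.
Qed.

(** [invsqrtmx] chooses an element of a set, with default 0. The spectral root P^T D^(-1/2) P shows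
    that the set is inhabited, so the default is excluded. *)
Lemma invsqrtmxP n (S : 'M[R]_n) : posdefmx S ->
  (invsqrtmx S)^T = invsqrtmx S /\ invsqrtmx S *m invsqrtmx S = invmx S.
Proof.
move=> pS; have [P [d [PP PP' SE d0]]] := posdef_diagonalization pS.
rewrite /invsqrtmx; case: xgetP => [Q _ [[? _] ?]//|].
pose e := \row_i (Num.sqrt (d 0 i))^-1.
move=> /(_ (P^T *m diag_mx e *m P)); case; split.
  by apply: posdef_diag => // i; rewrite mxE invr_gt0 sqrtr_gt0.
have dee : diag_mx e *m diag_mx e *m diag_mx d = 1%:M.
  rewrite !mulmx_diag; apply/matrixP => i j; rewrite !mxE -invfM -expr2.
  by rewrite sqr_sqrtr ?(ltW (d0 _))// mulVf// gt_eqF.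
set X := LHS; suff XS : X *m S = 1%:M.
  by rewrite -[LHS](mulmxK (posdef_unit pS)) XS mul1mx.
rewrite /X SE -!mulmxA (mulmxA P) PP mul1mx (mulmxA P) PP mul1mx.
by rewrite (mulmxA (diag_mx e) (diag_mx d)) (mulmxA (diag_mx e)) mulmxA dee mul1mx.
Qed.

End posdef.

Lemma card_multi_index K (n : 'I_K -> nat) : #|multi_index n| = (\prod_k n k)%N.
Proof.
by rewrite card_dep_ffun foldrE big_image/=; apply: eq_bigr => k _; rewrite card_ord.
Qed.

(** * Quadratic forms and products attached to Kronecker products *)

Section tensor_quad.
Context {R : realType} {K : nat}.
Implicit Types n m : 'I_K -> nat.

Lemma sqnorm_tensor_lin_kron n m (C : forall k, 'M[R]_(m k, n k)) M :
  tensor_sqnorm (tensor_lin (kron C) M) =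
  tensor_dot M (tensor_lin (kron (fun k => (C k)^T *m C k)) M).
Proof. by rewrite tensor_sqnormE tensor_dot_lin kron_tr tensor_lin_kron_comp. Qed.

(** The form vec(M)^T (S_1 x ... x S_K)^(-1) vec(M), with Kronecker products. It replaces the chosen
    square roots by inverses, whose entries are rational in those of the S_k; this is what makes
    limits accessible. *)
Definition tensor_quad n (S : forall k, 'M[R]_(n k)) (M : tensor R n) : R :=
  tensor_dot M (tensor_lin (kron (fun k => invmx (S k))) M).

Lemma sqnorm_kron_quad n m (C : forall k, 'M[R]_(m k, n k))
    (S : forall k, 'M[R]_(n k)) M :
  (forall k, (C k)^T *m C k = invmx (S k)) ->
  tensor_sqnorm (tensor_lin (kron C) M) = tensor_quad S M.
Proof.
move=> CS; rewrite sqnorm_tensor_lin_kron /tensor_quad.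
congr (tensor_dot M (tensor_lin (kron _) M)).
by apply: functional_extensionality_dep => k.
Qed.

Lemma sqnorm_invsqrt n (S : forall k, 'M[R]_(n k)) M :
  (forall k, posdefmx (S k)) ->
  tensor_sqnorm (multilinear_prod M (fun k => invsqrtmx (S k))) = tensor_quad S M.
Proof.
move=> pS; rewrite multilinear_prodE; apply: sqnorm_kron_quad => k.
by have [-> ->] := invsqrtmxP (pS k).
Qed.

Lemma tensor_quad_ge0 n (S : forall k, 'M[R]_(n k)) M :
  (forall k, posdefmx (S k)) -> 0 <= tensor_quad S M.
Proof.
by move=> pS; rewrite -sqnorm_invsqrt//; apply: sumr_ge0 => i _; exact: sqr_ge0.
Qed.

Lemma tensor_quad1 n (M : tensor R n) : tensor_quad (fun=> 1%:M) M = tensor_sqnorm M.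
Proof.
rewrite /tensor_quad (_ : (fun k => invmx 1%:M) = fun k => 1%:M :> 'M[R]_(n k)).
  by rewrite kron1 tensor_lin1 tensor_sqnormE.
by apply: functional_extensionality_dep => k; rewrite invmx1.
Qed.

Lemma tensor_lin_kron_diag n (e : forall k, 'rV[R]_(n k)) M :
  tensor_lin (kron (fun k => diag_mx (e k))) M =
  fun j => (\prod_k e k 0 (j k)) * M j.
Proof.
apply/funext => j; rewrite /tensor_lin (bigD1 j)//= big1 ?addr0.
  by rewrite mulrC; congr (_ * _); apply: eq_bigr => k _; rewrite mxE eqxx mulr1n.
move=> i /eqP ij; have [k jk] : exists k, j k != i k.
  apply/existsP; rewrite -negb_forall; apply/negP => /forallP h.
  by apply: ij; apply/ffunP => k; apply/esym/eqP.
by rewrite /kron (bigD1 k)//= mxE (negbTE jk) mulr0n mul0r mulr0.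
Qed.

(* For fixed k, each value of the index j_k occurs (\prod_l n_l) / n_k times. *)
Lemma prod_multi_index n (k : 'I_K) (e : 'I_(n k) -> R) :
  (forall l, 0 < n l)%N -> (forall l, 0 < e l) ->
  \prod_(j : multi_index n) e (j k) =
  (\prod_l e l) `^ ((\prod_l n l)%N%:R / (n k)%:R).
Proof.
move=> n0 e0.
have p0 : 0 < \prod_(j : multi_index n) e (j k) by exact: prodr_gt0.
have p1 : 0 < \prod_l e l by exact: prodr_gt0.
have lnprod (I : finType) (f : I -> R) : (forall i, 0 < f i) ->
    ln (\prod_i f i) = \sum_i ln (f i).
  move=> f0; rewrite -[RHS]expRK expR_sum; congr ln.
  by apply: eq_bigr => i _; rewrite lnK// posrE.
apply: ln_inj; rewrite ?posrE ?powR_gt0// ln_powR !lnprod//.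
(* Logarithms turn the claim into a sum over multi-indices of a product over modes, equal to 1 away
   from [k]. Taking a natural number as argument lets [g] be used at every mode without a cast along
   l = k. *)
pose g (a : nat) : R := if insub a is Some i then ln (e i) else 0.
pose F (l : 'I_K) (i : 'I_(n l)) : R := if l == k then g i else 1.
have gE i : g (i : 'I_(n k)) = ln (e i) by rewrite /g valK.
have := @sum_multi_index_prod R K n F.
rewrite [in RHS](bigD1 k)//= (eq_bigr (fun l => (n l)%:R)); last first.
  by move=> l lk; rewrite /F (negbTE lk) sumr_const card_ord.
rewrite (eq_bigr (fun j : multi_index n => ln (e (j k)))); last first.
  move=> j _; rewrite (bigD1 k)//= big1 ?mulr1; first by rewrite /F eqxx gE.
  by move=> l lk; rewrite /F (negbTE lk).
rewrite (eq_bigr (fun l => ln (e l))); last by move=> l _; rewrite /F eqxx gE.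
move=> ->; rewrite natr_prod [in RHS](bigD1 k)//= [RHS]mulrC; congr (_ * _).
by rewrite mulrAC divff ?mul1r// pnatr_eq0 -lt0n.
Qed.

End tensor_quad.

(** * Images of Gaussian and t laws *)

Section gaussian_image.
Context {R : realType} {K : nat}.
Implicit Types n r : 'I_K -> nat.
Local Notation leb n := (@tensor_lebesgue R K n).

(** This is det(S_1 x ... x S_K)^(-1/2): with N the product of the n_l, the determinant of the
    Kronecker product is the product of the det(S_k)^(N / n_k). *)
Definition cov_factor n (S : forall k, 'M[R]_(n k)) : R :=
  \prod_k (\det (S k)) `^ (- ((\prod_l n l)%N%:R / (2 * (n k)%:R))).

Definition gauss_cov n (S : forall k, 'M[R]_(n k)) (t : R) (M : tensor R n) : R :=
  cov_factor S * (Num.sqrt (t / pi) ^+ #|multi_index n| *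
                  expR (- (t * tensor_quad S M))).

Lemma cov_factor_ge0 n (S : forall k, 'M[R]_(n k)) : 0 <= cov_factor S.
Proof. by apply: prodr_ge0 => k _; exact: powR_ge0. Qed.

Lemma gauss_cov_ge0 n (S : forall k, 'M[R]_(n k)) t M : 0 <= gauss_cov S t M.
Proof. by rewrite mulr_ge0 ?cov_factor_ge0// mulr_ge0 ?expR_ge0// exprn_ge0. Qed.

Lemma gauss_cov1 n t (M : tensor R n) : gauss_cov (fun=> 1%:M) t M = gauss t M.
Proof.
rewrite /gauss_cov gaussE tensor_quad1 /cov_factor big1 ?mul1r// => k _.
by rewrite det1 powR1.
Qed.

Lemma measurable_tensor_quad n (S : forall k, 'M[R]_(n k)) :
  measurable_fun setT (tensor_quad S).
Proof.
apply: measurable_sum => i; apply: measurable_funM; first exact: measurable_coord.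
exact: (measurableT_comp (measurable_coord i) (measurable_tensor_lin _)).
Qed.

(** Applied with e = d^(-1/2), it identifies the Jacobian of the diagonal scaling. If x is the
    product of the e_k, then det S_k = x^(-2), and both sides have the factor x^(N / n_k) at mode
    k. *)
Lemma cov_factorE n (S : forall k, 'M[R]_(n k)) (e : forall k, 'I_(n k) -> R) :
  (forall k, 0 < n k)%N -> (forall k l, 0 < e k l) ->
  (forall k, (\prod_l e k l) ^+ 2 * \det (S k) = 1) ->
  \prod_(j : multi_index n) \prod_k e k (j k) = cov_factor S.
Proof.
move=> n0 e0 eS; rewrite exchange_big/=; apply: eq_bigr => k _.
rewrite prod_multi_index//; set x := \prod_l e k l.
have x0 : 0 < x by exact: prodr_gt0.
have Sx : \det (S k) = x `^ (- 2).
  have x2 : x ^+ 2 != 0 by rewrite expf_neq0// gt_eqF.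
  by rewrite powRN powR_mulrn ?(ltW x0)//; apply: (mulfI x2); rewrite eS mulfV.
rewrite Sx -powRrM; congr powR.
by field; rewrite pnatr_eq0 -lt0n.
Qed.

Local Open Scope ereal_scope.

Lemma ge0_integral_gauss_lin n r (A : forall k, 'M[R]_(n k, r k))
    (S : forall k, 'M[R]_(n k)) t (h : tensor R n -> \bar R) :
  (forall k, 0 < n k)%N -> (forall k, posdefmx (S k)) ->
  (forall k, A k *m (A k)^T = S k) -> (0 < t)%R ->
  measurable_fun setT h -> (forall M, 0 <= h M) ->
  \int[leb r]_M (h (tensor_lin (kron A) M) * (gauss t M)%:E) =
  \int[leb n]_M (h M * (gauss_cov S t M)%:E).
Proof.
move=> n0 pS AS t0 mh h0.
have pd k := cid (posdef_diagonalization (pS k)).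
pose P k := sval (pd k); have pd' k := cid (svalP (pd k)).
pose d k := sval (pd' k).
have PP k : P k *m (P k)^T = 1%:M by case: (svalP (pd' k)).
have PP' k : (P k)^T *m P k = 1%:M by case: (svalP (pd' k)).
have SE k : S k = (P k)^T *m diag_mx (d k) *m P k by case: (svalP (pd' k)).
have d0 k i : (0 < d k 0 i)%R by case: (svalP (pd' k)).
clearbody d P; clear pd pd'.
pose e k : 'rV[R]_(n k) := (\row_i Num.sqrt (d k 0 i))%R.
pose f k : 'rV[R]_(n k) := (\row_i (Num.sqrt (d k 0 i))^-1)%R.
have e0 k i : (0 < Num.sqrt (d k 0 i))%R by rewrite sqrtr_gt0.
have ef k : diag_mx (e k) *m diag_mx (f k) = 1%:M.
  by rewrite mulmx_diag; apply/matrixP => i j; rewrite !mxE divff// gt_eqF.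
have ffd k : diag_mx (f k) *m diag_mx (d k) *m diag_mx (f k) = 1%:M.
  rewrite !mulmx_diag; apply/matrixP => i j; rewrite !mxE.
  by rewrite mulrAC -invfM -expr2 sqr_sqrtr ?(ltW (d0 _ _))// mulVf// gt_eqF.
(* With D = diag(d), e = d^(1/2) and f = d^(-1/2), this gives A = P^T D^(1/2) O, and O O^T =
   D^(-1/2) P S P^T D^(-1/2) = 1. *)
pose O k := diag_mx (f k) *m P k *m A k.
have OO k : O k *m (O k)^T = 1%:M.
  rewrite /O !trmx_mul tr_diag_mx !mulmxA -(mulmxA _ (A k)) AS SE !mulmxA.
  by rewrite -(mulmxA _ (P k)) PP mulmx1 -(mulmxA _ (P k)) PP mulmx1.
pose h1 N := h (tensor_lin (kron (fun k => (P k)^T *m diag_mx (e k))) N).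
have mh1 : measurable_fun setT h1.
  exact: (measurableT_comp mh (measurable_tensor_lin _)).
have mg (p q : 'I_K -> nat) (a : multi_index q -> multi_index p -> R) :
    measurable_fun setT (fun M => (gauss t (tensor_lin a M))%:E).
  apply/measurable_EFinP.
  exact: (measurableT_comp (@measurable_gauss R K q t) (measurable_tensor_lin a)).
have mg1 p : measurable_fun setT (fun M : @tensor R K p => (gauss t M)%:E).
  by apply/measurable_EFinP; exact: measurable_gauss.
have -> : (fun M => h (tensor_lin (kron A) M) * (gauss t M)%:E) =
    (fun M => h1 (tensor_lin (kron O) M) * (gauss t M)%:E).
  apply/funext => M; rewrite /h1 tensor_lin_kron_comp.
  congr (h (tensor_lin (kron _) M) * _).
  apply: functional_extensionality_dep => k.
  by rewrite /O !mulmxA -(mulmxA _ (diag_mx (e k))) ef mulmx1 PP' mul1mx.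
rewrite (ge0_integral_coisometry (coisometry_kron OO) t0 mh1);
  last by move=> N; exact: h0.
(* Scaling by the inverse roots [f] cancels the factor diag(e) inside [h1]; the product of the [a j]
   becomes [cov_factor S]. *)
pose a (j : multi_index n) := (\prod_k f k 0 (j k))%R.
have a0 j : (0 < a j)%R by apply: prodr_gt0 => k _; rewrite mxE invr_gt0.
rewrite (ge0_integral_tensor_affine (fun=> 0%R) a0); last 2 first.
- by apply: (emeasurable_funM mh1); exact: mg1.
- by move=> N; apply: mule_ge0; [exact: h0|rewrite lee_fin gauss_ge0].
pose C k := diag_mx (f k) *m P k.
pose h2 N := h N * (gauss t (tensor_lin (kron C) N))%:E.
have mh2 : measurable_fun setT h2 by apply: (emeasurable_funM mh); exact: mg.
have h20 N : 0 <= h2 N by rewrite mule_ge0// lee_fin gauss_ge0.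
(* After the scaling, [h] sees P^T N and the Gaussian sees diag(f) N = C (P^T N). Both depend on P^T
   N, so the orthogonal factor can be removed; the identity C^T C = S^(-1) then yields the quadratic
   form. *)
rewrite [X in _ * X](_ : _ =
    \int[leb n]_N h2 (tensor_lin (kron (fun k => (P k)^T)) N)); last first.
  apply: eq_integral => N _.
  have -> : (fun j => a j * N j + 0)%R = tensor_lin (kron (fun k => diag_mx (f k))) N.
    by rewrite tensor_lin_kron_diag; apply/funext => j; rewrite addr0.
  rewrite /h1 /h2 !tensor_lin_kron_comp.
  have -> : (fun k => (P k)^T *m diag_mx (e k) *m diag_mx (f k)) = (fun k => (P k)^T).
    by apply: functional_extensionality_dep => k; rewrite -mulmxA ef mulmx1.
  have -> // : (fun k => C k *m (P k)^T) = (fun k => diag_mx (f k)).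
  by apply: functional_extensionality_dep => k; rewrite /C -mulmxA PP mulmx1.
rewrite ge0_integral_orthogonal//; last 2 first.
- by apply: coisometry_kron => k; rewrite trmxK.
- by rewrite kron_tr; apply: coisometry_kron => k; rewrite !trmxK.
rewrite -ge0_integralZl//; last by rewrite lee_fin; apply: prodr_ge0 => j _; exact: ltW.
apply: eq_integral => N _; rewrite /h2 muleCA -EFinM; congr (_ * _%:E).
rewrite /gauss_cov gaussE (@sqnorm_kron_quad _ _ _ _ _ S); last first.
  move=> k; rewrite /C trmx_mul tr_diag_mx.
  rewrite -[LHS](mulmxK (posdef_unit (pS k))); set X := (X in X *m _).
  suff -> : X = 1%:M by rewrite mul1mx.
  rewrite /X SE !mulmxA -(mulmxA _ (P k)) PP mulmx1.
  rewrite -[X in X *m P k]mulmxA -[X in X *m P k]mulmxA (mulmxA (diag_mx (f k))).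
  rewrite [diag_mx (f k) *m diag_mx (f k) *m _](_ : _ = 1%:M) ?mulmx1//.
  by rewrite !mulmx_diag; apply/matrixP => i j; have /matrixP/(_ i j) := ffd k;
    rewrite !mulmx_diag !mxE mulrAC.
congr (_ * _)%R; rewrite -(@cov_factorE n S (fun k l => f k 0%R l))//.
- by move=> k l; rewrite mxE invr_gt0.
- move=> k; have -> : \det (S k) = \det (diag_mx (d k)).
    by rewrite SE !det_mulmx mulrAC -det_mulmx PP' det1 mul1r.
  have /(congr1 determinant) := ffd k; rewrite !det_mulmx !det_diag det1 => fd.
  by rewrite -[RHS]fd expr2 mulrAC.
Qed.

End gaussian_image.

(** * Tensor t laws as Gamma mixtures of Gaussians *)

Section mixture.
Context {R : realType} {K : nat}.
Implicit Types n r : 'I_K -> nat.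
Local Notation mR := (measurableTypeR R).
Local Notation leb n := (@tensor_lebesgue R K n).
Local Notation lebR := (@lebesgue_measure R).

(** The Gamma density of shape nu / 2 and rate 1, extended by 0 so that Tonelli can be applied on
    the whole line. *)
Definition mixing_pdf (nu s : R) : R :=
  if 0 < s then gamma_fun (nu / 2) 1 s / Gamma (nu / 2) else 0.

Lemma mixing_pdf_ge0 nu s : 2 < nu -> 0 <= mixing_pdf nu s.
Proof.
move=> nu2; rewrite /mixing_pdf; case: ifP => // _.
by rewrite divr_ge0 ?gamma_fun_ge0// ltW// Gamma_gt0; lra.
Qed.

Lemma measurable_mixing_pdf nu : measurable_fun [set: mR] (mixing_pdf nu).
Proof.
apply: measurable_fun_ifT => //; first exact: measurable_fun_ltr.
by apply: measurable_funM => //; exact: measurable_gamma_fun.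
Qed.

Local Open Scope ereal_scope.

Lemma integral_mixing_pdf nu : (2 < nu)%R -> \int[lebR]_s (mixing_pdf nu s)%:E = 1.
Proof.
move=> nu2; have p1 : (1 < nu / 2)%R by lra.
have G0 := Gamma_gt0 p1.
transitivity (\int[lebR]_(s in `]0%R, +oo[)
    ((Gamma (nu / 2))^-1%:E * (gamma_fun (nu / 2) 1 s)%:E)).
  rewrite [RHS]integral_mkcond; apply: eq_integral => s _.
  rewrite /patch mem_setE in_itv/= andbT /mixing_pdf; case: ifP => // _.
  by rewrite -EFinM mulrC.
rewrite ge0_integralZl//; last 3 first.
- by apply/measurable_EFinP/measurable_funTS; exact: measurable_gamma_fun.
- by move=> s _; rewrite lee_fin gamma_fun_ge0.
- by rewrite lee_fin invr_ge0 ltW.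
by rewrite -GammaE// -EFinM mulVf// gt_eqF.
Qed.

Lemma tensor_t_pdf_ge0 n nu B (S : forall k, 'M[R]_(n k)) M :
  (2 < nu)%R -> (0 <= tensor_t_pdf nu B S M)%R.
Proof.
move=> nu2; rewrite /tensor_t_pdf mulr_ge0 ?powR_ge0// divr_ge0 ?mulr_ge0 ?powR_ge0//.
- rewrite ltW// Gamma_gt0//.
  have : (0 <= (\prod_k n k)%N%:R :> R)%R by rewrite ler0n.
  lra.
- by apply: prodr_ge0 => k _; exact: powR_ge0.
- by rewrite ltW// Gamma_gt0//; lra.
Qed.

Lemma tensor_t_pdfE n nu (S : forall k, 'M[R]_(n k)) M :
  (forall k, posdefmx (S k)) ->
  tensor_t_pdf nu (fun=> 0%R) S M =
  (cov_factor S / Gamma (nu / 2) *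
    (Gamma ((#|multi_index n|%:R + nu) / 2) / (nu * pi) `^ (#|multi_index n|%:R / 2) *
     (1 + nu^-1 * tensor_quad S M) `^ (- ((#|multi_index n|%:R + nu) / 2))))%R.
Proof.
move=> pS; rewrite /tensor_t_pdf card_multi_index.
have -> : (fun i => M i - 0)%R = M by apply/funext => i; rewrite subr0.
rewrite (sqnorm_invsqrt _ pS) -/(cov_factor S) invfM.
by ring.
Qed.

Lemma tensor_t_pdf_mixture n nu (S : forall k, 'M[R]_(n k)) M :
  (2 < nu)%R -> (forall k, posdefmx (S k)) ->
  (tensor_t_pdf nu (fun=> 0%R) S M)%:E =
  \int[lebR]_s ((mixing_pdf nu s)%:E * (gauss_cov S (s / nu) M)%:E).
Proof.
move=> nu2 pS; have p1 : (1 < nu / 2)%R by lra.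
have G0 := Gamma_gt0 p1; have nu0 : (0 < nu)%R by lra.
rewrite tensor_t_pdfE// EFinM -t_mixture//; last exact: tensor_quad_ge0.
rewrite -ge0_integralZl//; last 3 first.
- apply/measurable_EFinP/measurable_funTS; apply: measurable_funM.
    exact: measurable_gamma_fun.
  apply: measurable_funM.
    apply: measurable_funX; apply: measurableT_comp.
      by apply: continuous_measurable_fun; exact: sqrt_continuous.
    by apply: measurable_funM => //; exact: measurable_funM.
  apply: measurableT_comp => //; apply: measurableT_comp => //.
  by apply: measurable_funM => //; exact: measurable_funM.
- by move=> s _; rewrite lee_fin mulr_ge0 ?gamma_fun_ge0// mulr_ge0 ?expR_ge0//.
- by rewrite lee_fin divr_ge0 ?cov_factor_ge0// ltW.
rewrite integral_mkcond; apply: eq_integral => s _.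
rewrite /patch mem_setE in_itv/= andbT /mixing_pdf.
case: ifP => s0; last by rewrite mul0e.
rewrite -!EFinM; congr EFin; rewrite /gauss_cov.
move: (Num.sqrt _ ^+ _ * _)%R (gamma_fun _ _ _) (cov_factor S) => x y z.
by ring.
Qed.

Lemma measurable_gauss_cov_scale n (S : forall k, 'M[R]_(n k)) nu :
  measurable_fun setT (fun p : tensor R n * mR => gauss_cov S (p.2 / nu) p.1).
Proof.
have m2 : measurable_fun setT (fun p : tensor R n * mR => p.2 / nu : R)%R.
  by apply: measurable_funM => //; exact: measurable_snd.
apply: measurable_funM => //; apply: measurable_funM.
  apply: measurable_funX; apply: measurableT_comp.
    by apply: continuous_measurable_fun; exact: sqrt_continuous.
  by apply: measurable_funM.
apply: measurableT_comp => //; apply: measurableT_comp => //.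
apply: measurable_funM => //.
exact: (measurableT_comp (measurable_tensor_quad S) measurable_fst).
Qed.

Lemma measurable_gauss_cov n (S : forall k, 'M[R]_(n k)) t :
  measurable_fun setT (gauss_cov S t).
Proof.
apply: measurable_funM => //; apply: measurable_funM => //.
apply: measurableT_comp => //; apply: measurableT_comp => //.
by apply: measurable_funM => //; exact: measurable_tensor_quad.
Qed.

Lemma ge0_integral_tensor_t n nu (S : forall k, 'M[R]_(n k))
    (h : tensor R n -> \bar R) :
  (2 < nu)%R -> (forall k, posdefmx (S k)) ->
  measurable_fun setT h -> (forall M, 0 <= h M) ->
  \int[leb n]_M (h M * (tensor_t_pdf nu (fun=> 0%R) S M)%:E) =
  \int[lebR]_s ((mixing_pdf nu s)%:E *
                \int[leb n]_M (h M * (gauss_cov S (s / nu) M)%:E)).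
Proof.
move=> nu2 pS mh h0.
pose H (p : tensor R n * mR) :=
  (mixing_pdf nu p.2)%:E * (h p.1 * (gauss_cov S (p.2 / nu) p.1)%:E).
have mH : measurable_fun setT H.
  apply: emeasurable_funM.
    apply/measurable_EFinP.
    exact: (measurableT_comp (measurable_mixing_pdf nu) measurable_snd).
  apply: emeasurable_funM; first exact: (measurableT_comp mh measurable_fst).
  by apply/measurable_EFinP; exact: measurable_gauss_cov_scale.
have g0 s M : 0 <= (gauss_cov S s M)%:E by rewrite lee_fin gauss_cov_ge0.
have w0 s : 0 <= (mixing_pdf nu s)%:E by rewrite lee_fin mixing_pdf_ge0.
have H0 p : 0 <= H p by rewrite !mule_ge0.
transitivity (\int[leb n \x lebR]_p H p).
  rewrite fubini_tonelli1//; apply: eq_integral => M _.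
  rewrite tensor_t_pdf_mixture// -ge0_integralZl//; last 2 first.
  - apply: emeasurable_funM.
      by apply/measurable_EFinP; exact: measurable_mixing_pdf.
    apply/measurable_EFinP.
    exact: (measurableT_comp (measurable_gauss_cov_scale S nu) (pair1_measurable M)).
  - by move=> s _; rewrite mule_ge0.
  by apply: eq_integral => s _; rewrite muleCA.
rewrite fubini_tonelli2//; apply: eq_integral => s _.
rewrite /fubini_G /H/= ge0_integralZl//.
- by apply: (emeasurable_funM mh); apply/measurable_EFinP; exact: measurable_gauss_cov.
- by move=> M _; rewrite mule_ge0.
Qed.

(** The mixing weight depends neither on the shape nor on the covariances, so the Gaussian identity
    at each s, with t = s / nu, integrates to the t identity. *)
Lemma ge0_integral_t_lin n r nu (A : forall k, 'M[R]_(n k, r k))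
    (S : forall k, 'M[R]_(n k)) (h : tensor R n -> \bar R) :
  (2 < nu)%R -> (forall k, 0 < n k)%N -> (forall k, posdefmx (S k)) ->
  (forall k, A k *m (A k)^T = S k) ->
  measurable_fun setT h -> (forall M, 0 <= h M) ->
  \int[leb r]_M (h (tensor_lin (kron A) M) *
                 (tensor_t_pdf nu (fun=> 0%R) (fun=> 1%:M) M)%:E) =
  \int[leb n]_M (h M * (tensor_t_pdf nu (fun=> 0%R) S M)%:E).
Proof.
move=> nu2 n0 pS AS mh h0.
rewrite (@ge0_integral_tensor_t _ _ _ (h \o tensor_lin (kron A)))//; last 3 first.
- by move=> k; exact: posdefmx1.
- exact: (measurableT_comp mh (measurable_tensor_lin _)).
- by move=> M; exact: h0.
rewrite ge0_integral_tensor_t//; apply: eq_integral => s _.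
rewrite /mixing_pdf; case: ifPn => [s0|_]; last by rewrite !mul0e.
congr (_ * _); rewrite -(ge0_integral_gauss_lin _ _ AS)//; last first.
  by rewrite divr_gt0//; lra.
by apply: eq_integral => M _; rewrite gauss_cov1.
Qed.

(** With h = 1 and A_k = S_k^(1/2), obtained as the inverse of [invsqrtmx], the image identity
    reduces the total mass to identity covariances, where the Gaussians and the mixing weight have
    mass 1. *)
Lemma integral_tensor_t_pdf n nu (S : forall k, 'M[R]_(n k)) :
  (2 < nu)%R -> (forall k, 0 < n k)%N -> (forall k, posdefmx (S k)) ->
  \int[leb n]_M (tensor_t_pdf nu (fun=> 0%R) S M)%:E = 1.
Proof.
move=> nu2 n0 pS.
have AS k : invmx (invsqrtmx (S k)) *m (invmx (invsqrtmx (S k)))^T = S k.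
  have [QT QQ] := invsqrtmxP (pS k).
  have uS : invmx (S k) \in unitmx by rewrite unitmx_inv posdef_unit.
  have uQ : invsqrtmx (S k) \in unitmx by move: uS; rewrite -QQ unitmx_mul => /andP[].
  rewrite trmx_inv QT -[LHS](mulmxK uS) -[X in _ *m X *m _]QQ.
  by rewrite mulmxA mulmxKV// mulVmx// mul1mx invmxK.
transitivity (\int[leb n]_M (cst 1 M * (tensor_t_pdf nu (fun=> 0%R) S M)%:E)).
  by apply: eq_integral => M _; rewrite /= mul1e.
rewrite -(ge0_integral_t_lin _ _ _ AS)//.
rewrite (@ge0_integral_tensor_t _ _ _ (cst 1))//; last by move=> k; exact: posdefmx1.
rewrite -[RHS](integral_mixing_pdf nu2); apply: eq_integral => s _.
rewrite /mixing_pdf; case: ifPn => [s0|_]; last by rewrite mul0e.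
rewrite -[RHS]mule1; congr (_ * _).
rewrite -[RHS](@integral_gauss R K n (s / nu)); last by rewrite divr_gt0//; lra.
by apply: eq_integral => M _; rewrite /= mul1e gauss_cov1.
Qed.

End mixture.

(** * Densities *)

Section density.
Context d (T : measurableType d) (R : realType).
Local Open Scope ereal_scope.

(** [f] and the Radon-Nikodym derivative have equal integrals over every measurable set, hence agree
    almost everywhere, and the change of variables for the derivative applies to [f]. *)
Lemma ge0_integral_density (mu : {sigma_finite_measure set T -> \bar R})
    (nu : {finite_measure set T -> \bar R}) (f h : T -> \bar R) :
  measurable_fun setT f -> (forall x, 0 <= f x) ->
  (forall A, measurable A -> nu A = \int[mu]_(x in A) f x) ->
  measurable_fun setT h -> (forall x, 0 <= h x) ->
  \int[nu]_x h x = \int[mu]_x (h x * f x).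
Proof.
move=> mf f0 nuf mh h0.
have numu : nu `<< mu.
  apply/null_content_dominatesP => A mA muA0; rewrite nuf//.
  by apply: null_set_integral => //; exact: measurable_funTS.
rewrite -(Radon_Nikodym_SigmaFinite.change_of_variables numu)//.
have intf : mu.-integrable setT f.
  apply/integrableP; split => //.
  under eq_integral do rewrite gee0_abs//.
  by rewrite -nuf// ltey_eq fin_num_measure.
have iRN := Radon_Nikodym_SigmaFinite.f_integrable numu.
apply: ae_eq_integral => //.
- by apply: emeasurable_funM => //; exact: measurable_int iRN.
- exact: emeasurable_funM.
apply: ae_eqe_mul2l; apply: integral_ae_eq => //.
by move=> A _ mA; rewrite -nuf// -Radon_Nikodym_SigmaFinite.f_integral.
Qed.

End density.

Section scheffe.
Context d (T : measurableType d) (R : realType) (mu : {measure set T -> \bar R}).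
Local Open Scope ereal_scope.

(* Scheffe's lemma: the part of f_ r above min (f_ r) f has vanishing mass. *)
Lemma cvg_integral_densities (f_ : nat -> T -> R) (f k : T -> R) (c : R) :
  (forall r, measurable_fun setT (f_ r)) -> measurable_fun setT f ->
  (forall r x, 0 <= f_ r x)%R -> (forall x, 0 <= f x)%R ->
  (forall r, \int[mu]_x (f_ r x)%:E = 1) -> \int[mu]_x (f x)%:E = 1 ->
  (forall x, f_ ^~ x @ \oo --> f x) ->
  measurable_fun setT k -> (0 <= c)%R -> (forall x, 0 <= k x <= c)%R ->
  (fun r => \int[mu]_x (k x * f_ r x)%:E) @ \oo --> \int[mu]_x (k x * f x)%:E.
Proof.
move=> mf_ mf f_0 f0 intf_ intf f_f mk c0 kc.
have k0 x : (0 <= k x)%R by case/andP: (kc x).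
have kc' x : (k x <= c)%R by case/andP: (kc x).
pose g r x := Num.min (f_ r x) (f x).
have mg r : measurable_fun setT (g r) by exact: measurable_minr.
have g0 r x : (0 <= g r x)%R by rewrite le_min f_0 f0.
have gf r x : (g r x <= f x)%R by rewrite ge_min lexx orbT.
have gf_ r x : (g r x <= f_ r x)%R by rewrite ge_min lexx.
have g_f x : g ^~ x @ \oo --> f x.
  have : ((f_ r x + f x - `|f_ r x - f x|) / 2)%R @[r --> \oo] -->
      ((f x + f x - `|f x - f x|) / 2)%R.
    apply: cvgMl; apply: cvgB; first by apply: cvgD => //; exact: cvg_cst.
    by apply: cvg_norm; apply: cvgB => //; exact: cvg_cst.
  rewrite (_ : ((f x + f x - _) / 2)%R = f x); last by rewrite subrr normr0; lra.
  by rewrite /g; under [X in X @ _ --> _ -> _]eq_fun do rewrite -minr_absE.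
have intf' : mu.-integrable setT (EFin \o f).
  apply/integrableP; split; first exact/measurable_EFinP.
  under eq_integral do rewrite /= ger0_norm//.
  by rewrite intf ltry.
(* The minima lie below the integrable function [f], which gives a dominating function that the
   [f_ r] themselves may lack. *)
have cvg_dom (l : T -> R) (b : R) :
    measurable_fun setT l -> (forall x, 0 <= l x <= b)%R ->
    \int[mu]_x (l x * g r x)%:E @[r --> \oo] --> \int[mu]_x (l x * f x)%:E.
  move=> ml lb; apply: (@dominated_cvg _ _ _ _ _ _ _ _ (fun x => (b * f x)%:E)) => //.
  - by move=> r; apply/measurable_EFinP; exact: measurable_funM.
  - move=> x _; apply: cvg_EFin; first exact: nearW.
    by apply: cvgMr; exact: g_f.
  - under eq_fun do rewrite EFinM; exact: integrableZl.
  - move=> r x _; have /andP[l0 lb'] := lb x.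
    by rewrite /= lee_fin ger0_norm ?mulr_ge0// ler_pM.
have cvg_g : \int[mu]_x (g r x)%:E @[r --> \oo] --> 1.
  have := @cvg_dom (cst 1%R) 1%R; rewrite -intf.
  under eq_fun do under eq_integral do rewrite mul1r.
  under [X in _ --> X]eq_integral do rewrite mul1r.
  by apply => // x; rewrite ler01 lexx.
pose b r := \int[mu]_x (k x * (f_ r x - g r x))%:E.
have split_f r : \int[mu]_x (k x * f_ r x)%:E = \int[mu]_x (k x * g r x)%:E + b r.
  rewrite -ge0_integralD//.
  - by apply: eq_integral => x _; rewrite -EFinD -mulrDr addrC subrK.
  - by move=> x _; rewrite lee_fin mulr_ge0.
  - by apply/measurable_EFinP; exact: measurable_funM.
  - by move=> x _; rewrite lee_fin mulr_ge0// subr_ge0.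
  - by apply/measurable_EFinP; apply: measurable_funM => //; exact: measurable_funB.
have int_fg r : \int[mu]_x (f_ r x - g r x)%:E = 1 - \int[mu]_x (g r x)%:E.
  have gfin : \int[mu]_x (g r x)%:E \is a fin_num.
    rewrite ge0_fin_numE; last by apply: integral_ge0 => x _; rewrite lee_fin.
    apply: (@le_lt_trans _ _ 1); last exact: ltry.
    rewrite -intf; apply: ge0_le_integral => //.
    - by move=> x _; rewrite lee_fin.
    - exact/measurable_EFinP.
    - exact/measurable_EFinP.
    - by move=> x _; rewrite lee_fin.
  have -> : 1 = \int[mu]_x (f_ r x - g r x)%:E + \int[mu]_x (g r x)%:E.
    rewrite -ge0_integralD//.
    - by rewrite -(intf_ r); apply: eq_integral => x _; rewrite -EFinD subrK.
    - by move=> x _; rewrite lee_fin subr_ge0.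
    - by apply/measurable_EFinP; exact: measurable_funB.
    - by move=> x _; rewrite lee_fin.
    - exact/measurable_EFinP.
  by rewrite addeK.
(* The excess mass of [f_ r] over the minimum is 1 minus the mass of the minimum, which tends to 0;
   [k] multiplies it by at most [c]. *)
have b0 : b @ \oo --> 0.
  apply: (@squeeze_cvge _ _ _ _ (cst 0) _
    (fun r => c%:E * (1 - \int[mu]_x (g r x)%:E))).
  - apply: nearW => r; rewrite integral_ge0/=; last first.
      by move=> x _; rewrite lee_fin mulr_ge0// subr_ge0.
    rewrite -int_fg -ge0_integralZl//.
    + apply: ge0_le_integral => //.
      * by move=> x _; rewrite lee_fin mulr_ge0// subr_ge0.
      * by apply/measurable_EFinP; apply: measurable_funM => //; exact: measurable_funB.
      * by apply: measurable_funeM; apply/measurable_EFinP; exact: measurable_funB.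
      * by move=> x _; rewrite -EFinM lee_fin ler_wpM2r// subr_ge0.
    + by apply/measurable_EFinP; exact: measurable_funB.
    + by move=> x _; rewrite lee_fin subr_ge0.
  - exact: cvg_cst.
  - rewrite [X in _ --> X](_ : 0 = c%:E * (1 - 1)); last by rewrite subee// mule0.
    apply: cvgeZl => //; apply: cvgeB => //; exact: cvg_cst.
rewrite (_ : (fun r => _) = fun r => \int[mu]_x (k x * g r x)%:E + b r);
  last exact/funext.
rewrite -[X in _ --> X]adde0; apply: cvgeD => //; last exact: cvg_dom kc.
by rewrite fin_num_adde_defl.
Qed.

End scheffe.

Section density_probability.
Context d (T : measurableType d) (R : realType).
Variables (mu : {measure set T -> \bar R}) (f : T -> \bar R).
Hypotheses (mf : measurable_fun setT f) (f0 : forall x, (0 <= f x)%E).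
Local Open Scope ereal_scope.

Let nu (A : set T) : \bar R := \int[mu]_(x in A) f x.

Let nu0 : nu set0 = 0. Proof. exact: integral_set0. Qed.

Let nu_ge0 A : 0 <= nu A. Proof. by apply: integral_ge0 => x _. Qed.

Let nu_sigma_additive : semi_sigma_additive nu.
Proof.
move=> A mA tA mUA; rewrite /nu ge0_integral_bigcup//; last first.
  exact: measurable_funTS.
by apply: is_cvg_ereal_nneg_natsum_cond => n _ _; exact: nu_ge0.
Qed.

Lemma density_probability : \int[mu]_x f x = 1 ->
  exists P : probability T R, forall A, P A = \int[mu]_(x in A) f x.
Proof.
move=> f1.
pose nu_measure := isMeasure.Build _ _ _ nu nu0 nu_ge0 nu_sigma_additive.
pose m : {measure set T -> \bar R} := HB.pack nu nu_measure.
pose nu_prob := Measure_isProbability.Build _ _ _ m f1.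
pose P : probability T R := HB.pack nu nu_measure nu_prob.
by exists P.
Qed.

End density_probability.

(** * Convergence of the densities *)

Section limits.
Context {R : realType}.

Lemma cvg_sumr (I : Type) (s : seq I) (f : I -> nat -> R) (l : I -> R) :
  (forall i, f i @ \oo --> l i) ->
  (fun r => \sum_(i <- s) f i r) @ \oo --> \sum_(i <- s) l i.
Proof.
move=> fl; elim: s => [|i s IH].
  by rewrite big_nil; under eq_fun do rewrite big_nil; exact: cvg_cst.
rewrite big_cons; under eq_fun do rewrite big_cons.
by apply: cvgD => //; exact: fl.
Qed.

Lemma cvg_prodr (I : Type) (s : seq I) (f : I -> nat -> R) (l : I -> R) :
  (forall i, f i @ \oo --> l i) ->
  (fun r => \prod_(i <- s) f i r) @ \oo --> \prod_(i <- s) l i.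
Proof.
move=> fl; elim: s => [|i s IH].
  by rewrite big_nil; under eq_fun do rewrite big_nil; exact: cvg_cst.
rewrite big_cons; under eq_fun do rewrite big_cons.
by apply: cvgM => //; exact: fl.
Qed.

Lemma cvg_det n (A_ : nat -> 'M[R]_n) (A : 'M[R]_n) :
  (forall i j, (fun r => A_ r i j) @ \oo --> A i j) ->
  (fun r => \det (A_ r)) @ \oo --> \det A.
Proof.
move=> cA; rewrite /determinant; apply: cvg_sumr => s.
by apply: cvgM; [exact: cvg_cst|apply: cvg_prodr => i; exact: cA].
Qed.

(** Cramer's rule expresses the entries by determinants. Invertibility is required along the
    sequence because [invmx] returns a singular matrix unchanged. *)
Lemma cvg_invmx n (A_ : nat -> 'M[R]_n) (A : 'M[R]_n) i j :
  (forall r, A_ r \in unitmx) -> A \in unitmx ->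
  (forall i j, (fun r => A_ r i j) @ \oo --> A i j) ->
  (fun r => invmx (A_ r) i j) @ \oo --> invmx A i j.
Proof.
move=> uA_ uA cA; rewrite /invmx uA !mxE.
under eq_fun => r do rewrite uA_ !mxE.
apply: cvgM.
  by apply: cvgV; [rewrite -unitfE -unitmxE|exact: cvg_det].
rewrite /cofactor; apply: cvgM; first exact: cvg_cst.
apply: cvg_det => k l; rewrite !mxE.
under eq_fun => r do rewrite !mxE.
exact: cA.
Qed.

Lemma cvg_powR (u : nat -> R) (l p : R) : 0 < l ->
  u @ \oo --> l -> (fun r => u r `^ p) @ \oo --> l `^ p.
Proof.
move=> l0 ul; have dp : derivable (fun x : R => x `^ p) l 1.
  by apply: derivable_powR; rewrite in_itv/= l0.
have cp : {for l, continuous (fun x : R => x `^ p)}.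
  by move/derivable1_diffP : dp => /differentiable_continuous.
exact: (cvg_comp u (fun x : R => x `^ p) ul cp).
Qed.

Lemma gram_posdef m n (A : 'M[R]_(m, n)) :
  A *m A^T \in unitmx -> posdefmx (A *m A^T).
Proof.
move=> uA; split; first by rewrite trmx_mul trmxK.
move=> x x0; have -> : x *m (A *m A^T) *m x^T = (x *m A) *m (x *m A)^T.
  by rewrite trmx_mul !mulmxA.
apply: rv_dot_gt0; apply: contraNneq x0 => xA.
by rewrite -(mulmxK uA x) !mulmxA xA !mul0mx.
Qed.

End limits.

(** * Feature matrices and truncated kernels *)

Section kernels.
Context {R : realType} (V : Type) (phi : V -> nat -> R).
Hypothesis ell2 : ell2_features phi.

Lemma trunc_kernelE r u v : trunc_kernel phi r u v =
  series (fun i => phi u i * phi v i) r.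
Proof.
rewrite /trunc_kernel /series/= big_mkord mxE.
by apply: eq_bigr => i _; rewrite !mxE.
Qed.

(** Square summability gives absolute convergence, since |xy| <= x^2 + y^2. *)
Lemma cvg_trunc_kernel u v :
  (fun r => trunc_kernel phi r u v) @ \oo --> ell2_kernel phi u v.
Proof.
under eq_fun do rewrite trunc_kernelE.
suff : cvgn (series (fun i => phi u i * phi v i)) by [].
apply: normed_cvg.
apply: (@series_le_cvg _ _ (fun i => phi u i ^+ 2 + phi v i ^+ 2)).
- by move=> i; rewrite /= normr_ge0.
- by move=> i; rewrite addr_ge0// sqr_ge0.
- move=> i /=; rewrite normrM.
  rewrite -[phi u i ^+ 2]real_normK ?num_real// -[phi v i ^+ 2]real_normK ?num_real//.
  have := sqr_ge0 (`|phi u i| - `|phi v i|).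
  have : 0 <= `|phi u i| * `|phi v i| by rewrite mulr_ge0.
  by nra.
have e2 w : cvgn (series (fun i => phi w i ^+ 2)) by exact: ell2.
by have := is_cvg_seriesD (e2 u) (e2 v).
Qed.

Definition feature_mx r n (u : 'I_n -> V) : 'M[R]_(n, r) :=
  \matrix_(l, i) phi (u l) i.

Lemma feature_mx_gram r n (u : 'I_n -> V) :
  feature_mx r u *m (feature_mx r u)^T = cov_mx (trunc_kernel phi r) u.
Proof.
apply/matrixP => i j; rewrite !mxE /trunc_kernel mxE.
by apply: eq_bigr => k _; rewrite !mxE.
Qed.

Lemma eval_tensorE (K r : nat) (n : 'I_K -> nat) (u : forall k, 'I_(n k) -> V)
    (W : tensor R (fun _ : 'I_K => r)) :
  eval_tensor u (multilinear_fun phi W) =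
  tensor_lin (kron (fun k => feature_mx r (u k))) W.
Proof.
apply/funext => j; rewrite /eval_tensor /multilinear_fun multilinear_prodE.
apply: eq_bigr => i _; congr (_ * _); apply: eq_bigr => k _.
by rewrite ffunE !mxE.
Qed.

Lemma cvg_cov_mx n (u : 'I_n -> V) i j :
  (fun r => cov_mx (trunc_kernel phi r) u i j) @ \oo --> cov_mx (ell2_kernel phi) u i j.
Proof.
rewrite mxE; under eq_fun do rewrite mxE.
exact: cvg_trunc_kernel.
Qed.

(** A Gram matrix is positive semidefinite, so a nonzero determinant already makes it positive
    definite, and the determinants converge to a positive limit. *)
Lemma near_posdef_cov n (u : 'I_n -> V) : posdefmx (cov_mx (ell2_kernel phi) u) ->
  \forall r \near \oo, posdefmx (cov_mx (trunc_kernel phi r) u).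
Proof.
move=> /posdef_det_gt0 d0.
have := cvg_det (@cvg_cov_mx n u) => /cvgr_gt/(_ _ d0); apply: filterS => r dr.
rewrite -feature_mx_gram; apply: gram_posdef.
by rewrite feature_mx_gram unitmxE unitfE gt_eqF.
Qed.

(** In the form of [tensor_t_pdfE] the density involves the matrices only through determinants and
    inverse entries, and every varying power has a positive limiting base. *)
Lemma cvg_tensor_t_pdf (K : nat) (n : 'I_K -> nat) (nu : R)
    (S_ : nat -> forall k, 'M[R]_(n k)) (S : forall k, 'M[R]_(n k)) M :
  2 < nu -> (forall r k, posdefmx (S_ r k)) -> (forall k, posdefmx (S k)) ->
  (forall k i j, (fun r => S_ r k i j) @ \oo --> S k i j) ->
  (fun r => tensor_t_pdf nu (fun=> 0) (S_ r) M) @ \oo -->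
  tensor_t_pdf nu (fun=> 0) S M.
Proof.
move=> nu2 pS_ pS cS; rewrite tensor_t_pdfE//.
under eq_fun => r do rewrite (tensor_t_pdfE _ _ (pS_ r)).
apply: cvgM.
  apply: cvgM; last exact: cvg_cst.
  apply: cvg_prodr => k; apply: cvg_powR; first exact: posdef_det_gt0.
  exact: cvg_det.
apply: cvgM; first exact: cvg_cst.
apply: cvg_powR.
  rewrite ltr_pwDl// mulr_ge0 ?tensor_quad_ge0// invr_ge0; lra.
apply: cvgD; first exact: cvg_cst.
apply: cvgM; first exact: cvg_cst.
apply: cvg_sumr => i; apply: cvgM; first exact: cvg_cst.
apply: cvg_sumr => j; apply: cvgM; first exact: cvg_cst.
apply: cvg_prodr => k; apply: cvg_invmx => //.
- by move=> r; exact: posdef_unit.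
- exact: posdef_unit.
Qed.

End kernels.

(** * Convergence in distribution *)

Section continuous_tensor.
Context {R : realType} {K : nat} (n : 'I_K -> nat).

Lemma cvg_tensor (x_ : nat -> tensor R n) (x : tensor R n) :
  (forall i, (fun r => x_ r i) @ \oo --> x i) -> x_ @ \oo --> x.
Proof.
move=> cx; apply/cvg_sup => i; apply/cvg_image.
  by rewrite eqEsubset; split => // y _; exists (fun=> y).
move=> A /cx [N _ NA]; exists (@^~ i @^-1` A).
  by exists N => // r /NA.
by rewrite image_preimage// eqEsubset; split => // y _; exists (fun=> y).
Qed.

(* [h] is the pointwise limit of its compositions with the roundings of the
   coordinates to multiples of 1/m, which have countably many fibers. *)
Lemma continuous_tensor_measurable (h : tensor R n -> R) :
  continuous h -> measurable_fun setT h.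
Proof.
move=> ch.
pose g (m : nat) (M : tensor R n) : {ffun multi_index n -> int} :=
  [ffun i => Num.floor (M i * m.+1%:R)].
pose q (m : nat) (c : {ffun multi_index n -> int}) : tensor R n :=
  fun i => (c i)%:~R / m.+1%:R.
apply: (@measurable_fun_cvg _ _ _ _ (fun m M => h (q m (g m M)))) => [m|M _].
  move=> _ B mB; rewrite setTI.
  have -> : (fun M => h (q m (g m M))) @^-1` B =
      \bigcup_c [set M | g m M = c /\ B (h (q m c))].
    apply/seteqP; split => [M/= BM|M/= [c _ [<-]]//].
    by exists (g m M).
  apply: countable_bigcupT_measurable => [|c]; first exact: countableP.
  have [Bc|Bc] := pselect (B (h (q m c))); last first.
    by rewrite (_ : [set _ | _] = set0)//; apply/seteqP; split => M //= [].
  have -> : [set M | g m M = c /\ B (h (q m c))] =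
      \big[setI/setT]_(i : multi_index n)
        [set M : tensor R n | M i * m.+1%:R \in `[(c i)%:~R, (c i + 1)%:~R[].
    rewrite -bigcap_seq; apply/seteqP; split => M /=.
      move=> [gc _] i _ /=; rewrite in_itv/= -floor_eq.
      by move/ffunP/(_ i) : gc; rewrite ffunE => ->.
    move=> Mc; split=> //; apply/ffunP => i; rewrite ffunE; apply/eqP.
    by rewrite floor_eq; have := Mc i (mem_index_enum i); rewrite /= in_itv.
  apply: bigsetI_measurable => i _.
  have : measurable_fun setT (fun M : tensor R n => M i * m.+1%:R).
    by apply: measurable_funM => //; exact: measurable_coord.
  move=> /(_ measurableT `[(c i)%:~R, (c i + 1)%:~R[%classic).
  by rewrite setTI; apply; exact: measurable_itv.
apply: (cvg_comp (fun m => q m (g m M)) h _ (ch M)).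
apply: cvg_tensor => i; rewrite /q /g.
under eq_fun do rewrite ffunE.
(* Rounding down to a multiple of 1/(m + 1) lowers an entry by at most 1/(m + 1). *)
apply: (@squeeze_cvgr _ _ _ _ (fun m : nat => M i - m.+1%:R^-1) (fun=> M i)).
- apply: nearW => m; have m0 : 0 < m.+1%:R :> R by rewrite ltr0n.
  have /andP[lo hi] := floor_itv (M i * m.+1%:R).
  rewrite ler_pdivrMr// lo andbT ler_pdivlMr// mulrBl mulVf ?gt_eqF// lerBlDr.
  by move: hi; rewrite intrD => /ltW.
- rewrite -[X in _ --> X]subr0; apply: cvgB; first exact: cvg_cst.
  exact: cvg_harmonic.
- exact: cvg_cst.
Qed.

End continuous_tensor.

(** * Tensor t laws: expectations, linear images, limits and existence *)

Section laws.
Context {R : realType} {K : nat}.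
Implicit Types (n : 'I_K -> nat).
Local Notation leb n := (@tensor_lebesgue R K n).

Lemma measurable_tensor_t_pdf n nu (S : forall k, 'M[R]_(n k)) :
  (forall k, posdefmx (S k)) -> measurable_fun setT (tensor_t_pdf nu (fun=> 0) S).
Proof.
move=> pS.
rewrite (_ : tensor_t_pdf _ _ _ = fun M => tensor_t_pdf nu (fun=> 0) S M)//.
under eq_fun => M do rewrite tensor_t_pdfE//.
apply: measurable_funM => //; apply: measurable_funM => //.
apply: (measurableT_comp (measurable_powR _)).
apply: measurable_funD => //; apply: measurable_funM => //.
exact: measurable_tensor_quad.
Qed.

Local Open Scope ereal_scope.

(** Adding the bound [c] makes the integrand nonnegative, as the integral identities require;
    subtracting it afterwards is harmless because [P] has mass 1. *)
Lemma expectation_tensor_t d (T : measurableType d) (P : probability T R) n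
    (X : T -> tensor R n) nu (S : forall k, 'M[R]_(n k)) (h : tensor R n -> R)
    (c : R) :
  (2 < nu)%R -> has_tensor_t_law P X nu (fun=> 0%R) S ->
  measurable_fun setT h -> (forall M, `|h M| <= c)%R ->
  'E_P[h \o X] = \int[leb n]_M ((h M + c) * tensor_t_pdf nu (fun=> 0%R) S M)%:E - c%:E.
Proof.
move=> nu2 [mX pS XS] mh hc.
have hc0 M : (0 <= h M + c)%R by have := hc M; rewrite ler_norml => /andP[]; lra.
have hc1 M : (h M + c <= c + c)%R by have := hc M; rewrite ler_norml => /andP[]; lra.
have mhc : measurable_fun setT (fun M : tensor R n => (h M + c)%:E).
  by apply/measurable_EFinP; exact: measurable_funD.
pose PX := pushforward P X.
have iX : P.-integrable setT (fun w => (h (X w) + c)%:E).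
  apply: (@le_integrable _ _ _ P setT measurableT _ (EFin \o cst (c + c)%R)).
  - exact: measurableT_comp mhc mX.
  - move=> w _; rewrite /= lee_fin !ger0_norm//.
    exact: le_trans (hc0 (X w)) (hc1 (X w)).
  - exact: finite_measure_integrable_cst.
have -> : 'E_P[h \o X] = \int[P]_w (h (X w) + c)%:E - c%:E.
  rewrite unlock -[X in _ = _ - X](_ : \int[P]_w c%:E = c%:E); last first.
    by rewrite integral_cst//= probability_setT mule1.
  rewrite -integralB_EFin//; last exact: finite_measure_integrable_cst.
  by apply: eq_integral => w _; rewrite -EFinB addrK.
congr (_ - _).
transitivity (\int[distribution P (mfun_Sub (mem_set mX))]_M (h M + c)%:E).
  by rewrite ge0_integral_pushforward// => M _; rewrite lee_fin.
rewrite (@ge0_integral_density _ _ _ (leb n) _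
  (fun M => (tensor_t_pdf nu (fun=> 0%R) S M)%:E))//.
- by apply/measurable_EFinP; exact: measurable_tensor_t_pdf.
- by move=> M; rewrite lee_fin tensor_t_pdf_ge0.
Qed.

Lemma has_tensor_t_law_lin d (T : measurableType d) (P : probability T R) n m
    (X : T -> tensor R n) nu (A : forall k, 'M[R]_(m k, n k))
    (S : forall k, 'M[R]_(m k)) :
  (2 < nu)%R -> (forall k, 0 < m k)%N -> (forall k, posdefmx (S k)) ->
  (forall k, A k *m (A k)^T = S k) ->
  has_tensor_t_law P X nu (fun=> 0%R) (fun=> 1%:M) ->
  has_tensor_t_law P (fun w => tensor_lin (kron A) (X w)) nu (fun=> 0%R) S.
Proof.
move=> nu2 m0 pS AS [mX _ XS]; split => //.
  exact: (measurableT_comp (measurable_tensor_lin _) mX).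
move=> B mB.
have mLB : measurable (tensor_lin (kron A) @^-1` B).
  by rewrite -[X in measurable X]setTI; exact: measurable_tensor_lin.
have indicE p (C : set (tensor R p)) (f : tensor R p -> R) :
    \int[leb p]_(M in C) (f M)%:E = \int[leb p]_M ((\1_C M)%:E * (f M)%:E).
  rewrite integral_mkcond epatch_indic; apply: eq_integral => M _.
  by rewrite /= muleC.
transitivity (P (X @^-1` (tensor_lin (kron A) @^-1` B))); first by [].
(* The indicator of the preimage is the indicator of [B] composed with the linear map, so the image
   identity applies to the indicator of [B]. *)
rewrite XS// [LHS]indicE [RHS]indicE.
rewrite -(ge0_integral_t_lin nu2 m0 pS AS)//.
by apply/measurable_EFinP; exact: measurable_indic.
Qed.

Lemma cvg_in_distribution_tensor_t n nu (S_ : nat -> forall k, 'M[R]_(n k))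
    (S : forall k, 'M[R]_(n k))
    (d : nat -> measure_display) (T : forall r, measurableType (d r))
    (P : forall r, probability (T r) R) (X : forall r, T r -> tensor R n)
    d' (T' : measurableType d') (P' : probability T' R) (Y : T' -> tensor R n) :
  (2 < nu)%R -> (forall k, 0 < n k)%N ->
  (\forall r \near \oo, has_tensor_t_law (P r) (X r) nu (fun=> 0%R) (S_ r)) ->
  has_tensor_t_law P' Y nu (fun=> 0%R) S ->
  (forall k i j, (fun r => S_ r k i j) @ \oo --> S k i j) ->
  cvg_in_distribution P X P' Y.
Proof.
move=> nu2 n0 [r0 _ XS_] YS cS h ch [c hc].
have mh := continuous_tensor_measurable ch.
(* The t law holds only from some [r0] on; shifting the sequence by [r0] makes it hold at every
   index without changing the limit. *)
have XS r :
    has_tensor_t_law (P (r + r0)%N) (X (r + r0)%N) nu (fun=> 0%R) (S_ (r + r0)%N).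
  by apply: XS_; rewrite /= leq_addl.
rewrite -(cvg_shiftn r0) (expectation_tensor_t nu2 YS mh hc).
rewrite (_ : [sequence _]_r = fun r => \int[leb n]_M
   ((h M + c) * tensor_t_pdf nu (fun=> 0%R) (S_ (r + r0)%N) M)%:E - c%:E); last first.
  by apply/funext => r; rewrite /= (expectation_tensor_t nu2 (XS r) mh hc).
have pS_ r k : posdefmx (S_ (r + r0)%N k) by case: (XS r).
have pS k : posdefmx (S k) by case: YS.
have c0 : (0 <= c)%R by exact: le_trans (normr_ge0 _) (hc (fun=> 0%R)).
apply: cvgeB; [by rewrite fin_num_adde_defl// fin_numN|..|exact: cvg_cst].
apply: (@cvg_integral_densities _ _ _ _ _ _ (fun M => h M + c)%R (c + c)%R).
- by move=> r; exact: measurable_tensor_t_pdf.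
- exact: measurable_tensor_t_pdf.
- by move=> r M; exact: tensor_t_pdf_ge0.
- by move=> M; exact: tensor_t_pdf_ge0.
- by move=> r; exact: integral_tensor_t_pdf.
- exact: integral_tensor_t_pdf.
- move=> M; apply: cvg_tensor_t_pdf => // k i j.
  by rewrite (cvg_shiftn r0 (fun r => S_ r k i j)); exact: cS.
- exact: measurable_funD.
- by rewrite addr_ge0.
- by move=> M; have := hc M; rewrite ler_norml => /andP[? ?]; apply/andP; split; lra.
Qed.

Lemma exists_tensor_t_law n nu (S : forall k, 'M[R]_(n k)) :
  (2 < nu)%R -> (forall k, 0 < n k)%N -> (forall k, posdefmx (S k)) ->
  exists mu : probability (tensor R n) R,
    has_tensor_t_law mu id nu (fun=> 0%R) S.
Proof.
move=> nu2 n0 pS.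
have [|M|mu muE] := @density_probability _ _ _ (leb n)
  (fun M => (tensor_t_pdf nu (fun=> 0%R) S M)%:E) _ _ (integral_tensor_t_pdf nu2 n0 pS).
- by apply/measurable_EFinP; exact: measurable_tensor_t_pdf.
- by rewrite lee_fin tensor_t_pdf_ge0.
by exists mu; split.
Qed.

End laws.

(** A singular covariance gives no law in the sense of [has_tensor_t_law], hence the positive
    definiteness conditions on the locations. The second clause constructs the limit law itself, so
    convergence does not presuppose a process; the third identifies the limit with the evaluations
    of any given process. *)
Theorem theorem2 (R : realType) (K d : nat) (nu : R)
    (U : 'I_K -> set 'rV[R]_d) (phi : 'rV[R]_d -> nat -> R)
    (disp : nat -> measure_display)
    (Omega : forall r : nat, measurableType (disp r))
    (P : forall r : nat, probability (Omega r) R)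
    (W : forall r : nat, Omega r -> tensor R (fun _ : 'I_K => r)) :
  (1 <= K)%N -> (1 <= d)%N -> 2 < nu ->
  ell2_features phi ->
  (forall r : nat, (0 < r)%N ->
     has_tensor_t_law (P r) (W r) nu (fun=> 0) (fun=> 1%:M)) ->
  [/\ forall (r : nat) (n : 'I_K -> nat) (u : forall k, 'I_(n k) -> 'rV[R]_d),
        (0 < r)%N -> locations U u ->
        (forall k, posdefmx (cov_mx (trunc_kernel phi r) (u k))) ->
        has_tensor_t_law (P r)
          (fun w => eval_tensor u (multilinear_fun phi (W r w))) nu (fun=> 0)
          (fun k => cov_mx (trunc_kernel phi r) (u k)),
      forall (n : 'I_K -> nat) (u : forall k, 'I_(n k) -> 'rV[R]_d),
        locations U u ->
        (forall k, posdefmx (cov_mx (ell2_kernel phi) (u k))) ->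
        exists2 mu : probability (tensor R n) R,
          has_tensor_t_law mu id nu (fun=> 0)
            (fun k => cov_mx (ell2_kernel phi) (u k)) &
          cvg_in_distribution P
            (fun r w => eval_tensor u (multilinear_fun phi (W r w))) mu id
    & forall (disp' : measure_display) (Omega' : measurableType disp')
          (P' : probability Omega' R) (f : Omega' -> ('I_K -> 'rV[R]_d) -> R),
        tensor_t_process U P' f nu (fun=> 0) (fun=> ell2_kernel phi) ->
        forall (n : 'I_K -> nat) (u : forall k, 'I_(n k) -> 'rV[R]_d),
          locations U u ->
          cvg_in_distribution P
            (fun r w => eval_tensor u (multilinear_fun phi (W r w)))
            P' (fun w => eval_tensor u (f w))].
Proof.
move=> _ _ nu2 ell2 WP.
have law (r : nat) (n : 'I_K -> nat) (u : forall k, 'I_(n k) -> 'rV[R]_d) :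
    (0 < r)%N -> locations U u ->
    (forall k, posdefmx (cov_mx (trunc_kernel phi r) (u k))) ->
    has_tensor_t_law (P r)
      (fun w => eval_tensor u (multilinear_fun phi (W r w))) nu (fun=> 0)
      (fun k => cov_mx (trunc_kernel phi r) (u k)).
  move=> r0 lu pS.
  rewrite (_ : (fun w => _) = fun w =>
    tensor_lin (kron (fun k => feature_mx phi r (u k))) (W r w)); last first.
    by apply/funext => w; rewrite eval_tensorE.
  apply: has_tensor_t_law_lin => //; last exact: WP.
    by move=> k; case: (lu k).
  by move=> k; exact: feature_mx_gram.
have cvg_law d' (T' : measurableType d') (P' : probability T' R)
    (n : 'I_K -> nat) (u : forall k, 'I_(n k) -> 'rV[R]_d) (Y : T' -> tensor R n) :
    locations U u ->
    has_tensor_t_law P' Y nu (fun=> 0) (fun k => cov_mx (ell2_kernel phi) (u k)) ->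
    cvg_in_distribution P
      (fun r w => eval_tensor u (multilinear_fun phi (W r w))) P' Y.
  move=> lu YS.
  apply: (@cvg_in_distribution_tensor_t _ _ n nu
    (fun r k => cov_mx (trunc_kernel phi r) (u k)) _ _ _ _ _ _ _ _ _ nu2 _ _ YS).
  - by move=> k; case: (lu k).
  (* There are finitely many modes, so the thresholds for the separate covariance matrices combine
     into one. *)
  - have pS : \forall r \near \oo,
        forall k, posdefmx (cov_mx (trunc_kernel phi r) (u k)).
      by apply: filter_forall => k; apply: near_posdef_cov => //; case: YS.
    near=> r; apply: law => //.
      by near: r; exact: nbhs_infty_gt.
    by near: r; exact: pS.
  - by move=> k i j; exact: cvg_cov_mx.
split => //.
- move=> n u lu pS.
  have n0 k : (0 < n k)%N by case: (lu k).
  have [mu muS] := exists_tensor_t_law nu2 n0 pS.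
  by exists mu => //; exact: cvg_law.
- move=> disp' Omega' P' f fP n u lu.
  by apply: cvg_law => //; exact: fP.
Unshelve. all: by end_near.
Qed.
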